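(* For every positive integer $n$ and distinct numbers $a_1,\ldots,a_n\in(0,\infty)$ there exists a constant $C\in(0,\infty)$ with the following properties. (a) If $R\in(1,\infty)$ and $A\subseteq[0,R]^2$ is a Lebesgue-measurable set with density $$\frac{|A|}{R^2}\geq\Big(\frac{C}{\log R}\Big)^{1/(2n+1)},$$ then there exist $z\in\mathbb{R}^2$ and vectors $v_1,\ldots,v_n\in\mathscr{H}$ such that the $n+1$ points $$z,\ z+a_1v_1,\ \ldots,\ z+a_nv_n$$ all belong to $A$. (b) If $R\in(0,\infty)$ and the square $[0,R]^2$ is measurably colored in $r$ colors, then $$R\geq\exp\big(Cr^{2n+1}\big)$$ guarantees that there exist $z\in\mathbb{R}^2$ and vectors $v_1,\ldots,v_n\in\mathscr{H}$ such that the $n+1$ points $z,\ z+a_1v_1,\ \ldots,\ z+a_nv_n$ all belong to the same color-class.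
   Context: $\mathscr{H}=\{(x,y)\in\mathbb{R}^2: x^2-y^2=1\}$ is the standard hyperbola. $|A|$ denotes Lebesgue measure. A measurable coloring of a set in $r$ colors is a partition of it into $r$ Lebesgue-measurable sets, called color-classes. *)

(* Defs.v *)
From mathcomp Require Import all_boot all_order all_algebra.
From mathcomp Require Import all_classical all_reals all_analysis.
From mathcomp Require Import measurable_realfun.
Set Implicit Arguments.
Unset Strict Implicit.
Unset Printing Implicit Defensive.
Import Order.TTheory GRing.Theory Num.Theory.
Import numFieldNormedType.Exports.
Local Open Scope classical_set_scope.
Local Open Scope ring_scope.

Definition hyperbola (R : realType) : set (R * R) :=
  [set v | v.1 ^+ 2 - v.2 ^+ 2 = 1].

Definition square (R : realType) (L : R) : set (R * R) :=
  `[0, L] `*` `[0, L].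

(* Product of the one-dimensional Lebesgue measures, carried by the Borel
   sigma-algebra of the plane only. *)
Definition borel_lebesgue2 (R : realType) :
    {measure set (measurableTypeR R * measurableTypeR R) -> \bar R} :=
  (@lebesgue_measure R \x @lebesgue_measure R)%E.

(* Lebesgue-measurable sets of the plane are those of the completion: a Borel
   set together with a subset of a Borel null set. *)
Definition lebesgue_measurable2 (R : realType) : set (set (R * R)) :=
  completed_algebra_gen (@borel_lebesgue2 R).

(* Given by the outer measure, hence meaningful on all Lebesgue-measurable sets
   and not only on Borel ones. *)
Definition lebesgue2 (R : realType) : set (R * R) -> \bar R :=
  @completed_measure_extension _ _ _ (@borel_lebesgue2 R).

(* Color-classes are allowed to be empty, so at most r colors are used. *)
Definition measurable_coloring (R : realType) (D : set (R * R)) (r : nat)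
    (c : 'I_r -> set (R * R)) : Prop :=
  [/\ cover setT c = D, trivIset setT c &
      forall j, lebesgue_measurable2 (c j)].

Definition has_configuration (R : realType) (n : nat) (a : 'I_n -> R)
    (A : set (R * R)) : Prop :=
  exists (z : R * R) (v : 'I_n -> R * R),
    [/\ forall i, @hyperbola R (v i), A z & forall i, A (z + a i *: v i)].

(* Main.v *)
Require Import Defs.
From mathcomp Require Import all_boot all_order all_algebra.
From mathcomp Require Import all_classical all_reals all_analysis.
From mathcomp Require Import measurable_realfun ring lra.
Set Implicit Arguments.
Unset Strict Implicit.
Unset Printing Implicit Defensive.
Import Order.TTheory GRing.Theory Num.Theory.
Import numFieldNormedType.Exports.
Local Open Scope classical_set_scope.
Local Open Scope ring_scope.

(** In the coordinates [u = x - y], [w = x + y] the hyperbola is [u w = 1]. Let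
    [B] be a Borel subset of [[0, L]^2] of measure [m >= delta L^2] and let
    [c(v)] be the measure of the intersection of [B] with its translate by
    [a v]; as a function of [v], [c] is positive definite. For [k < K] let
    [t = e^x] with [x] uniform on an interval of radius [d = log (18/delta)],
    roughly, about [k Lambda], and compare the random point [(t, 1/t)] of the
    hyperbola with [(t, 1/t')], where [t'] is an independent copy of [t].
    Two facts drive the proof. First, Cauchy-Schwarz applied to the points
    [i (r, w)], [1 <= i <= N], for log-uniform [r] and [w] gives
    [E c(t, 1/t') >= (delta/72) m], because multiplication by an integer only
    translates a log-uniform law. Second, for [k < l] the four correlations
    between the points of scale [k] and those of scale [l] all agree, up to
    [O(e^(2d - Lambda)) m], with the single quantity [E c(t_l, -1/t_k)], hence
    cancel in [c(b_l-b_k) + c(s_l-s_k) - c(b_l-s_k) - c(s_l-b_k)]. If [E c(t, 1/t)]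
    vanished at every scale, then positive definiteness (Bessel's inequality)
    would force [K delta^2 = O(1)]; since all scales fit into the square as soon
    as [log L >= C delta^-3], such a [B] has density less than [delta].

    For [n] dilations, let [B_i] be the set of [z] in [A] from which the point
    [z + a_i v] lies in [A] for almost no [v] at any of the scales. Each [B_i]
    has density less than [delta/n], so some [z] in [A] is in none of them, and
    the [v_i] can be chosen independently of one another. This needs only
    [log L >= C delta^-3], which the exponent [2n + 1 >= 3] provides. *)


(** * Expectations of bounded measurable functions *)

Section bounded_measurable.
Context (R : realType).
Implicit Types (d : measure_display).

(** Such functions are integrable against every probability and stable under sums, scalar multiples,
    sections and partial expectations, so means can be manipulated without separate integrability
    arguments. *)
Definition bounded_measurable d (T : measurableType d) (g : T -> R) :=
  measurable_fun setT g /\ exists M, forall x, `|g x| <= M.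

Lemma bounded_measurable_cst d (T : measurableType d) (k : R) :
  bounded_measurable (fun _ : T => k).
Proof. by split; [exact: measurable_cst | exists `|k|]. Qed.

Lemma bounded_measurableD d (T : measurableType d) (f g : T -> R) :
  bounded_measurable f -> bounded_measurable g ->
  bounded_measurable (fun x => f x + g x).
Proof.
move=> [mf [M fM]] [mg [N gN]]; split; first exact: measurable_funD.
by exists (M + N) => x; rewrite (le_trans (ler_normD _ _))// lerD.
Qed.

Lemma bounded_measurableZ d (T : measurableType d) (k : R) (f : T -> R) :
  bounded_measurable f -> bounded_measurable (fun x => k * f x).
Proof.
move=> [mf [M fM]]; split; first exact: measurable_funM.
by exists (`|k| * M) => x; rewrite normrM ler_wpM2l.
Qed.

Lemma bounded_measurableN d (T : measurableType d) (f : T -> R) :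
  bounded_measurable f -> bounded_measurable (fun x => - f x).
Proof.
move=> /(bounded_measurableZ (-1)); congr bounded_measurable.
by apply/funext => x; rewrite mulN1r.
Qed.

Lemma bounded_measurableB d (T : measurableType d) (f g : T -> R) :
  bounded_measurable f -> bounded_measurable g ->
  bounded_measurable (fun x => f x - g x).
Proof. by move=> bf /bounded_measurableN; exact: bounded_measurableD. Qed.

Lemma bounded_measurable_sum d (T : measurableType d) (I : Type) (s : seq I)
    (F : I -> T -> R) : (forall i, bounded_measurable (F i)) ->
  bounded_measurable (fun x => \sum_(i <- s) F i x).
Proof.
move=> bF; elim: s => [|i s IH].
  by under eq_fun do rewrite big_nil; exact: bounded_measurable_cst.
by under eq_fun do rewrite big_cons; exact: bounded_measurableD.
Qed.

Lemma bounded_measurable_comp d d' (T : measurableType d)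
    (T' : measurableType d') (f : T' -> R) (h : T -> T') :
  bounded_measurable f -> measurable_fun setT h ->
  bounded_measurable (fun x => f (h x)).
Proof.
move=> [mf [M fM]] mh; split; last by exists M => x; exact: fM.
exact: measurableT_comp.
Qed.

Lemma bounded_measurable_pairl d d' (T : measurableType d)
    (T' : measurableType d') (f : T * T' -> R) (x : T) :
  bounded_measurable f -> bounded_measurable (fun y => f (x, y)).
Proof. by move/bounded_measurable_comp; apply; exact: measurable_pair1. Qed.

Lemma bounded_measurable_pairr d d' (T : measurableType d)
    (T' : measurableType d') (f : T * T' -> R) (y : T') :
  bounded_measurable f -> bounded_measurable (fun x => f (x, y)).
Proof. by move/bounded_measurable_comp; apply; exact: measurable_pair2. Qed.

Section expectation.
Context d (T : measurableType d) (P : probability T R).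
Implicit Types f g : T -> R.

Lemma bounded_measurable_integrable f :
  bounded_measurable f -> P.-integrable setT (EFin \o f).
Proof.
move=> [mf [M fM]]; apply: measurable_bounded_integrable => //.
  by rewrite (le_lt_trans (probability_le1 _ _))// ltry.
exists M; split; first exact: num_real.
by move=> N MN x _; exact: (le_trans (fM x) (ltW MN)).
Qed.

Lemma mean_cst (k : R) : \int[P]_x k = k.
Proof. by rewrite Rintegral_cst// [X in fine X](probability_setT P) mulr1. Qed.

Lemma mean_le f g : bounded_measurable f -> bounded_measurable g ->
  (forall x, f x <= g x) -> \int[P]_x f x <= \int[P]_x g x.
Proof.
by move=> *; apply: le_Rintegral => //; exact: bounded_measurable_integrable.
Qed.

Lemma meanD f g : bounded_measurable f -> bounded_measurable g ->
  \int[P]_x (f x + g x) = \int[P]_x f x + \int[P]_x g x.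
Proof.
by move=> *; apply: RintegralD => //; exact: bounded_measurable_integrable.
Qed.

Lemma meanB f g : bounded_measurable f -> bounded_measurable g ->
  \int[P]_x (f x - g x) = \int[P]_x f x - \int[P]_x g x.
Proof.
by move=> *; apply: RintegralB => //; exact: bounded_measurable_integrable.
Qed.

Lemma meanZ (k : R) f : bounded_measurable f ->
  \int[P]_x (k * f x) = k * \int[P]_x f x.
Proof.
by move=> *; apply: RintegralZl => //; exact: bounded_measurable_integrable.
Qed.

Lemma mean_sum (I : Type) (s : seq I) (F : I -> T -> R) :
  (forall i, bounded_measurable (F i)) ->
  \int[P]_x (\sum_(i <- s) F i x) = \sum_(i <- s) \int[P]_x F i x.
Proof.
move=> bF; elim: s => [|i s IH].
  under [LHS]eq_Rintegral do rewrite big_nil.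
  by rewrite big_nil mean_cst.
under [LHS]eq_Rintegral do rewrite big_cons.
by rewrite big_cons meanD ?IH//; exact: bounded_measurable_sum.
Qed.

Lemma mean_dist f g (e : R) :
  bounded_measurable f -> bounded_measurable g ->
  (forall x, `|f x - g x| <= e) -> `|\int[P]_x f x - \int[P]_x g x| <= e.
Proof.
move=> bf bg fg; have up (u v : T -> R) : bounded_measurable u -> bounded_measurable v ->
    (forall x, u x - v x <= e) -> \int[P]_x u x - \int[P]_x v x <= e.
  move=> bu bv uv; rewrite -meanB// -[leRHS]mean_cst.
  by apply: mean_le => //;
    [exact: bounded_measurableB|exact: bounded_measurable_cst].
rewrite ler_norml; apply/andP; split; last first.
  by apply: up => // x; have := fg x; rewrite ler_norml => /andP[].
rewrite lerNl opprB; apply: up => // x.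
by have := fg x; rewrite ler_norml => /andP[]; lra.
Qed.

End expectation.

Section double_expectation.
Context d d' (T : measurableType d) (T' : measurableType d').
Variables (P : probability T R) (P' : probability T' R).
Implicit Types f : T * T' -> R.

Lemma bounded_measurable_expectationr f : bounded_measurable f ->
  bounded_measurable (fun x => \int[P']_y f (x, y)).
Proof.
move=> bf; have [mf [M fM]] := bf; split.
  (* Adding the bound [M] makes the integrand nonnegative, so that Tonelli gives measurability; the
     constant is subtracted afterwards. *)
  have M0 : forall z, (0 <= (f z + M)%:E)%E.
    move=> z; rewrite lee_fin; have := fM z; rewrite ler_norml => /andP[]; lra.
  have mfM : measurable_fun setT (fun z => (f z + M)%:E).
    by apply/measurable_EFinP; exact: measurable_funD.
  have -> : (fun x => \int[P']_y f (x, y)) =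
     (fun x => \int[P']_y (f (x, y) + M) - M).
    apply/funext => x; rewrite meanD ?mean_cst ?addrK//.
      exact: bounded_measurable_pairl.
    exact: bounded_measurable_cst.
  apply: measurable_funB => //.
  have := measurable_fun_fubini_tonelli_F (m2 := P') _ mfM M0.
  by move=> /(measurableT_comp (@fine_measurable R setT measurableT)).
exists M => x; rewrite -[\int[P']_y _]subr0 -(@mean_cst _ _ P' 0).
apply: mean_dist; [exact: bounded_measurable_pairl|
  exact: bounded_measurable_cst|by move=> y; rewrite subr0].
Qed.

Lemma mean_swap f : bounded_measurable f ->
  \int[P]_x \int[P']_y f (x, y) = \int[P']_y \int[P]_x f (x, y).
Proof.
move=> bf; have [mf [M fM]] := bf; rewrite /Rintegral.
have fin (x : T) : (\int[P']_y (f (x, y))%:E)%E \is a fin_num.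
  apply: integrable_fin_num => //.
  exact: (bounded_measurable_integrable _ (bounded_measurable_pairl x bf)).
have fin' (y : T') : (\int[P]_x (f (x, y))%:E)%E \is a fin_num.
  apply: integrable_fin_num => //.
  exact: (bounded_measurable_integrable _ (bounded_measurable_pairr y bf)).
under [in LHS]eq_integral do rewrite fineK//.
under [in RHS]eq_integral do rewrite fineK//.
congr fine; apply: (@Fubini _ _ _ _ _ P P' (EFin \o f)) => //.
apply/integrable12ltyP; first exact/measurable_EFinP.
apply: (@le_lt_trans _ _ (\int[P]_x \int[P']_y M%:E)%E).
  apply: ge0_le_integral => //.
  - by move=> x _; exact: integral_ge0.
  - apply: (measurable_fun_fubini_tonelli_F (m2 := P') (abse \o (EFin \o f))).
      by apply: measurableT_comp => //; exact/measurable_EFinP.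
    by move=> x /=; rewrite lee_fin.
  - move=> x _; apply: ge0_le_integral => //.
    + apply: measurableT_comp => //; apply/measurable_EFinP.
      exact: (bounded_measurable_pairl x bf).1.
    + by move=> y _; rewrite lee_fin fM.
by under eq_integral do rewrite integral_cst//= probability_setT mule1;
  rewrite integral_cst//= probability_setT mule1 ltry.
Qed.

End double_expectation.

End bounded_measurable.

(** * Averaging an inequality whose terms involve the variables in pairs *)

Section pair_expectation.
Context (R : realType) d (T : measurableType d) (P : nat -> probability T R).

(* Only the marginals of pairs occur, so the variables can be averaged out one
   at a time, and no product of all the [P k] is needed. *)
Lemma pair_expectation_ge0 (K : nat) (A : R) (p : nat -> T -> R)
    (q : nat -> nat -> T * T -> R) :
  (forall k, bounded_measurable (p k)) ->
  (forall l k, bounded_measurable (q l k)) ->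
  (forall om : nat -> T, 0 <= A + \sum_(k < K) p k (om k) +
     \sum_(k < K) \sum_(l < k) q l k (om l, om k)) ->
  0 <= A + \sum_(k < K) \int[P k]_x p k x +
     \sum_(k < K) \sum_(l < k) \int[P l]_x \int[P k]_y q l k (x, y).
Proof.
move=> bp bq; elim: K A p bp => [|K IH] A p bp H.
  by have := H (fun=> point); rewrite !big_ord0.
(* The induction averages out the last variable: its interaction with [x] becomes a function of [x]
   alone and joins [p l]. *)
pose p' l x := p l x + \int[P K]_y q l K (x, y).
have bq' l : bounded_measurable (fun x => \int[P K]_y q l K (x, y)).
  exact: bounded_measurable_expectationr.
have {}IH := IH (A + \int[P K]_x p K x) p' (fun l => bounded_measurableD (bp l) (bq' l)).
rewrite !big_ord_recr/=.
have -> (a b c e f : R) : a + (b + c) + (e + f) = a + c + (b + f) + e by ring.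
rewrite -big_split/=; under eq_bigr do rewrite -meanD//.
apply: IH => om; rewrite /p' big_split/=.
pose omy y j := if j == K then y else om j.
have omyE y j : (j < K)%N -> omy y j = om j by rewrite /omy => /ltn_eqF ->.
have {}H y : 0 <= (A + \sum_(k < K) p k (om k) +
     \sum_(k < K) \sum_(l < k) q l k (om l, om k)) +
     (p K y + \sum_(l < K) q l K (om l, y)).
  have E1 : \sum_(k < K) p k (omy y k) = \sum_(k < K) p k (om k).
    by apply: eq_bigr => k _; rewrite omyE.
  have E2 : \sum_(k < K) \sum_(l < k) q l k (omy y l, omy y k) =
      \sum_(k < K) \sum_(l < k) q l k (om l, om k).
    apply: eq_bigr => k _; apply: eq_bigr => l _.
    by rewrite !omyE// (ltn_trans (ltn_ord l)).
  have E3 : \sum_(l < K) q l K (omy y l, omy y K) =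
      \sum_(l < K) q l K (om l, y).
    by apply: eq_bigr => l _; rewrite omyE// /omy eqxx.
  have := H (omy y); rewrite !big_ord_recr/= E1 E2 E3 /omy eqxx.
  by congr (_ <= _); ring.
have bs : bounded_measurable (fun y => \sum_(l < K) q l K (om l, y)).
  by apply: bounded_measurable_sum => l; exact: bounded_measurable_pairl.
have : 0 <= \int[P K]_y ((A + \sum_(k < K) p k (om k) +
     \sum_(k < K) \sum_(l < k) q l k (om l, om k)) +
     (p K y + \sum_(l < K) q l K (om l, y))) by apply: Rintegral_ge0.
rewrite meanD ?mean_cst//; last 2 first.
- exact: bounded_measurable_cst.
- exact: bounded_measurableD.
rewrite meanD// mean_sum => [|l]; last exact: bounded_measurable_pairl.
by congr (_ <= _); ring.
Qed.

End pair_expectation.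

(** * Gram matrices of sets *)

Section gram.
Context (R : realType) d (T : measurableType d) (mu : {measure set T -> \bar R}).

Lemma Rintegral_sum (I : Type) (s : seq I) (F : I -> T -> R) :
  (forall i, mu.-integrable setT (EFin \o F i)) ->
  mu.-integrable setT (EFin \o (fun x => \sum_(i <- s) F i x)) /\
  \int[mu]_x (\sum_(i <- s) F i x) = \sum_(i <- s) \int[mu]_x F i x.
Proof.
move=> iF; elim: s => [|i s [IH1 IH2]].
  have -> : (fun x => \sum_(i <- [::]) F i x) = cst 0.
    by apply/funext => x; rewrite big_nil.
  by split; [exact: integrable0|rewrite big_nil Rintegral_cst// mul0r].
have -> : (fun x => \sum_(j <- i :: s) F j x) =
    (fun x => F i x + \sum_(j <- s) F j x).
  by apply/funext => x; rewrite big_cons.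
split; first exact: (integrableD measurableT (iF i) IH1).
by rewrite big_cons RintegralD// IH2.
Qed.

(** The form is the integral of the square of [\sum_i w i * \1_(B i)]. *)
Lemma gram_ge0 (I : finType) (B : I -> set T) (w : I -> R) :
  (forall i, measurable (B i)) -> (forall i, (mu (B i) < +oo)%E) ->
  0 <= \sum_i \sum_j w i * w j * fine (mu (B i `&` B j)).
Proof.
move=> mB fB.
have mBB i j : measurable (B i `&` B j) by exact: measurableI.
have fBB i j : (mu (B i `&` B j) < +oo)%E.
  by rewrite (le_lt_trans _ (fB i))// le_measure ?inE.
have iI i j : mu.-integrable setT (EFin \o \1_(B i `&` B j)).
  apply/integrableP; split; first exact/measurable_EFinP.
  under eq_integral do rewrite /= ger0_norm//.
  by rewrite integral_indic// setIT.
have iBB i j : mu.-integrable setT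
    (EFin \o (fun x => w i * w j * \1_(B i `&` B j) x)).
  exact: (integrableZl measurableT _ (iI i j)).
have iS i := (Rintegral_sum (index_enum I) (iBB i)).1.
have -> : \sum_i \sum_j w i * w j * fine (mu (B i `&` B j)) =
    \int[mu]_x (\sum_i \sum_j w i * w j * \1_(B i `&` B j) x).
  rewrite (Rintegral_sum _ iS).2; apply: eq_bigr => i _.
  rewrite (Rintegral_sum _ (iBB i)).2; apply: eq_bigr => j _.
  rewrite (RintegralZl _ measurableT (iI i j)).
  by rewrite /Rintegral integral_indic// setIT.
apply: Rintegral_ge0 => x _.
rewrite [leRHS](_ : _ = (\sum_i w i * \1_(B i) x) ^+ 2) ?sqr_ge0//.
rewrite expr2 mulr_suml; apply: eq_bigr => i _.
rewrite mulr_sumr; apply: eq_bigr => j _.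
by rewrite indicI /=; ring.
Qed.

End gram.

(** * Translation invariance in one and two dimensions *)

Section translation.
Context (R : realType).
Local Notation mR := (measurableTypeR R).

Lemma lebesgue_measure_shift (t : R) (A : set mR) : measurable A ->
  lebesgue_measure [set x : mR | A (x + t)] = lebesgue_measure A.
Proof.
move=> mA; have ms : measurable_fun setT (fun x : mR => (x + t : mR)).
  exact: measurable_funD.
pose nu := pushforward (@lebesgue_measure R) (fun x : mR => (x + t : mR)).
pose nu' : {measure set mR -> \bar R} := nu.
rewrite [RHS](@lebesgue_measure_unique R (nu' ms))//.
move=> X [[a b] _ <-]; rewrite /nu' /= /nu /pushforward.
have -> : (fun x => x + t) @^-1` `]a, b] = `]a - t, b - t]%classic.
  by apply/seteqP; split => x /=; rewrite !in_itv/= ltrBlDr lerBrDr.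
by rewrite !lebesgue_measure_itv/= !lte_fin ltrD2r -!EFinD; case: ifP => // _;
  congr (_%:E); ring.
Qed.

(** A product measure is determined by its values on measurable rectangles, where the
    one-dimensional statement applies to each side. *)
Lemma borel_lebesgue2_shift (v : R * R) (A : set (mR * mR)) : measurable A ->
  borel_lebesgue2 R [set z : mR * mR | A (z + v)] = borel_lebesgue2 R A.
Proof.
move=> mA; have ms : measurable_fun setT (fun z : mR * mR => (z + v : mR * mR)).
  apply: measurable_fun_pair; apply: measurable_funD => //.
pose nu := pushforward (borel_lebesgue2 R) (fun z : mR * mR => (z + v : mR * mR)).
pose nu' : {measure set (mR * mR) -> \bar R} := nu.
rewrite [RHS](_ : _ = nu' ms A)//; apply: product_measure_unique => // X Y mX mY.
rewrite /nu' /= /nu /pushforward.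
have -> : (fun z => z + v) @^-1` (X `*` Y) =
  [set x : mR | X (x + v.1)] `*` [set y : mR | Y (y + v.2)] by [].
have mshift (t : R) (Z : set mR) : measurable Z -> measurable [set x : mR | Z (x + t)].
  move=> mZ; have mt : measurable_fun setT (fun x : mR => (x + t : mR)).
    exact: measurable_funD.
  by have := mt measurableT Z mZ; rewrite setTI.
rewrite /borel_lebesgue2 product_measure1E; [|exact: mshift|exact: mshift].
by congr (_ * _)%E; exact: lebesgue_measure_shift.
Qed.

End translation.

(** * Expanding maps of the line *)

Section expanding.
Context (R : realType).
Local Notation mR := (measurableTypeR R).
Local Notation lambda := (@lebesgue_measure R).

Lemma lebesgue_measure_diameter (Z : set mR) (D : R) : measurable Z -> 0 <= D ->
  (forall x y, Z x -> Z y -> x - y <= D) -> (lambda Z <= D%:E)%E.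
Proof.
move=> mZ D0 ZD; have [->|/set0P[z Zz]] := eqVneq Z set0.
  by rewrite measure0 lee_fin.
have hZ : has_inf (Z : set R).
  by split; [exists z|exists (z - D) => y Zy; have := ZD z y Zz Zy; lra].
apply: (@le_trans _ _ (lambda `[inf (Z : set R), inf (Z : set R) + D])).
  apply: le_measure; [by rewrite inE|by rewrite inE; exact: measurable_itv|].
  move=> y Zy; have iy : inf (Z : set R) <= y := ge_inf hZ.2 Zy.
  have yi : y - D <= inf (Z : set R).
    by apply: lb_le_inf; [exists z|move=> x Zx; have := ZD y x Zy Zx; lra].
  by rewrite /= in_itv/= iy -lerBlDr.
rewrite lebesgue_measure_itv/= lte_fin; case: ifP => _; last by rewrite lee_fin.
by rewrite -?EFinB lee_fin addrAC subrr add0r.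
Qed.

(** Lebesgue measure is an infimum over countable covers of [S] by half-open intervals. The part of
    [J] that [psi] maps into an interval of length [l] has diameter, hence measure, at most
    [l / k]. *)
Lemma expanding_preimage_le (J : set mR) (psi : mR -> mR) (k : R) :
  measurable J -> measurable_fun setT psi -> 0 < k ->
  (forall x y, J x -> J y -> k * `|x - y| <= `|psi x - psi y|) ->
  forall S : set mR, measurable S ->
  (k%:E * lambda (J `&` psi @^-1` S) <= lambda S)%E.
Proof.
move=> mJ mpsi k0 ex S mS.
have mpre (U : set mR) : measurable U -> measurable (J `&` psi @^-1` U).
  by move=> mU; apply: measurableI => //; rewrite -[X in measurable X]setTI; exact: mpsi.
rewrite {2}/lambda /lebesgue_measure /lebesgue_stieltjes_measure /measure_extension.
apply: le_ereal_inf_tmp => _ [F [mF SF] <-].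
have mF' n : measurable (F n : set mR) by exact: sub_sigma_algebra.
apply: (@le_trans _ _ (k%:E * \sum_(n <oo) lambda (J `&` psi @^-1` (F n))))%E.
  rewrite lee_pmul2l//; apply: measure_sigma_subadditive.
  - by move=> n; exact: mpre.
  - exact: mpre.
  - by move=> x [Jx /SF[n _ Fx]]; exists n.
rewrite -nneseriesZl//.
apply: lee_nneseries => [n _|n _]; first by rewrite mule_ge0// lee_fin ltW.
have := @measurable_mu_extE _ R _ (wlength idfun) _ (mF n).
have : (k%:E * lambda (J `&` psi @^-1` (F n)) <= lambda (F n))%E; last first.
  by move=> + <-.
have := mF n => -[[a b] _ /= FE].
have {}FE : F n = `]a, b]%classic by rewrite -FE.
have [ab|ba] := ltP a b; last first.
  have -> : J `&` psi @^-1` F n = set0.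
    rewrite FE; apply/seteqP; split => // x [_] /=; rewrite in_itv/= => /andP[]; lra.
  by rewrite measure0 mule0.
rewrite [leRHS](_ : _ = (b - a)%:E); last first.
  by rewrite FE lebesgue_measure_itv/= lte_fin ab EFinB.
rewrite muleC -lee_pdivlMr// -EFinM.
apply: lebesgue_measure_diameter; first exact: mpre.
  by rewrite divr_ge0 ?ltW// subr_gt0.
move=> x y [Jx +] [Jy +]; rewrite FE /= !in_itv/= => /andP[h1 h2] /andP[h3 h4].
rewrite ler_pdivlMr// mulrC (le_trans _ (le_trans (ex _ _ Jx Jy) _))//.
  by rewrite ler_pM2l// ler_norm.
by rewrite ler_norml; apply/andP; split; lra.
Qed.

End expanding.

(** * Perturbations of a uniform law *)

Section uniform_perturbation.
Context (R : realType) (a b : R) (ab : a < b).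
Local Notation mR := (measurableTypeR R).
Local Notation lambda := (@lebesgue_measure R).
Local Notation U := (uniform_prob ab).

Lemma uniform_probE (S : set mR) : measurable S ->
  U S = ((b - a)^-1%:E * lambda (`[a, b]%classic `&` S))%E.
Proof.
move=> mS; transitivity (\int[U]_x (\1_S x)%:E)%E.
  by rewrite integral_indic// setIT.
rewrite integral_uniform//; last exact/measurable_EFinP.
by rewrite integral_indic// setIC.
Qed.

(* x + p x expands distances by at least 1 - e and stays in [a - e, b + e], so
   its law is at most (1 - e)^-1 / (b - a) times Lebesgue measure there. *)
Lemma uniform_perturbation_le (p g : R -> R) (e m : R) :
  2 <= b - a -> 0 <= e -> e <= 2^-1 ->
  measurable_fun setT (p : mR -> mR) ->
  (forall x, a <= x <= b -> `|p x| <= e) ->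
  (forall x y, a <= x <= b -> a <= y <= b -> `|p x - p y| <= e * `|x - y|) ->
  measurable_fun setT (g : mR -> R) -> (forall x, 0 <= g x <= m) ->
  \int[U]_x g (x + p x) <= \int[U]_x g x + 4 * e * m.
Proof.
move=> ba2 e0 e12 mp pe plip mg gm.
have m0 : 0 <= m by have /andP[] := gm 0; exact: le_trans.
have g0 x : 0 <= g x by have /andP[] := gm x.
pose psi : mR -> mR := fun x => x + p x.
have mpsi : measurable_fun setT psi by exact: measurable_funD.
pose J : set mR := `[a, b]%classic.
have mJ : measurable J by exact: measurable_itv.
(* [h] dominates [g] on [[a - e, b + e]], which contains the image of [J] under [psi]: outside [J]
   it is at least [m] on the two overhanging intervals of length [e]. *)
pose h (x : mR) : R := (g \_ J) x + (m * \1_`[a - e, a] x + m * \1_`[b, b + e] x).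
have mgJ : measurable_fun setT (g \_ J).
  by apply/(measurable_restrictT _ _).1 => //; exact: measurable_funTS.
have mI (u v : R) : measurable_fun setT (fun x : mR => m * \1_`[u, v] x).
  by apply: measurable_funM => //; exact: measurable_indic.
have mh : measurable_fun setT h.
  by apply: measurable_funD => //; exact: measurable_funD.
have gJ0 x : 0 <= (g \_ J) x by rewrite patchE; case: ifP.
have I0 (u v : R) (x : mR) : 0 <= m * \1_`[u, v] x by rewrite mulr_ge0.
have h0 x : 0 <= h x by rewrite !addr_ge0.
have gh x : J x -> g (psi x) <= h (psi x).
  rewrite /J /= in_itv/= => Jx; have px := pe x Jx.
  move: px Jx; rewrite ler_norml => /andP[p1 p2] /andP[ax xb].
  rewrite /h patchE; case: ifPn => [_|]; first by rewrite lerDl addr_ge0.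
  rewrite notin_setE /J /= in_itv/= => /negP; rewrite negb_and -!ltNge => /orP[|] H.
    have I1 : psi x \in (`[a - e, a]%classic : set mR).
      by rewrite inE /= in_itv/= (ltW H) andbT /psi; lra.
    rewrite [X in _ + (_ * X + _)]indicE I1 mulr1.
    by rewrite add0r; have := I0 b (b + e) (psi x); have /andP[_] := gm (psi x); lra.
  have I1 : psi x \in (`[b, b + e]%classic : set mR).
    by rewrite inE /= in_itv/= (ltW H)/= /psi; lra.
  rewrite [X in _ + (_ + _ * X)]indicE I1 mulr1.
  by rewrite add0r; have := I0 (a - e) a (psi x); have /andP[_] := gm (psi x); lra.
have lem : ((b - a)^-1%:E * \int[lambda]_(x in J) (g (psi x))%:E <=
    ((1 - e)^-1 * (b - a)^-1)%:E * \int[lambda]_x (h x)%:E)%E.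
  have c0 : 0 <= (1 - e)^-1 * (b - a)^-1.
    by rewrite mulr_ge0// invr_ge0; lra.
  apply: (@le_trans _ _ (\int[U]_x (h (psi x))%:E)%E).
    rewrite integral_uniform//; last 2 first.
    - by apply/measurable_EFinP; exact: measurableT_comp.
    - by move=> x; rewrite lee_fin.
    rewrite lee_pmul2l//; last by rewrite lte_fin invr_gt0; lra.
    apply: ge0_le_integral => //.
    - by move=> x _; rewrite lee_fin.
    - by apply/measurable_EFinP/measurable_funTS; exact: measurableT_comp.
    - by apply/measurable_EFinP/measurable_funTS; exact: measurableT_comp.
  have -> : (((1 - e)^-1 * (b - a)^-1)%:E * \int[lambda]_x (h x)%:E =
      \int[mscale (NngNum c0) lambda]_x (h x)%:E)%E.
    rewrite ge0_integral_mscale//; first exact/measurable_EFinP.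
    by move=> x _; rewrite lee_fin.
  have -> : (\int[U]_x (h (psi x))%:E =
      \int[pushforward U psi]_x (h x)%:E)%E.
    rewrite ge0_integral_pushforward//; first exact/measurable_EFinP.
    by move=> x _; rewrite /= lee_fin.
  apply: ge0_le_measure_integral => //; last exact/measurable_EFinP.
  move=> S mS; rewrite /pushforward /mscale/=.
  have mpre : measurable (psi @^-1` S).
    by rewrite -[X in measurable X]setTI; exact: mpsi.
  rewrite [leLHS](uniform_probE mpre).
  rewrite [leRHS](_ : _ = (b - a)^-1%:E * ((1 - e)^-1%:E * lambda S))%E; last first.
    by rewrite muleA -EFinM [X in _ = (X%:E * _)%E]mulrC.
  rewrite lee_pmul2l//; last by rewrite lte_fin invr_gt0; lra.
  rewrite muleC lee_pdivlMr; last by lra.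
  rewrite muleC; apply: expanding_preimage_le => //; first by lra.
  move=> x y; rewrite /J /= !in_itv/= => Jx Jy; have := plip x y Jx Jy.
  rewrite /psi => H.
  have : `|x - y| <= `|x + p x - (y + p y)| + `|p x - p y|.
    have {1}-> : x - y = x + p x - (y + p y) - (p x - p y) by ring.
    exact: ler_normB.
  lra.
have inth : (\int[lambda]_x (h x)%:E <=
    \int[lambda]_(x in J) (g x)%:E + (2 * e * m)%:E)%E.
  under eq_integral do rewrite /h EFinD.
  rewrite ge0_integralD//; last 4 first.
  - by move=> x _; rewrite lee_fin.
  - exact/measurable_EFinP.
  - by move=> x _; rewrite lee_fin addr_ge0.
  - by apply/measurable_EFinP; exact: measurable_funD.
  apply: leeD.
    by rewrite [leRHS]integral_mkcond restrict_EFin.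
  under eq_integral do rewrite EFinD.
  rewrite ge0_integralD//; last 4 first.
  - by move=> x _; rewrite lee_fin.
  - exact/measurable_EFinP.
  - by move=> x _; rewrite lee_fin.
  - exact/measurable_EFinP.
  have lamI (u : R) : lambda `[u, u + e]%classic = e%:E.
    rewrite lebesgue_measure_itv/= lte_fin.
    case: ifPn => [_|ue]; first by rewrite -EFinB; congr EFin; ring.
    by have -> : e = 0 by lra.
  have intI (u : R) : (\int[lambda]_x (m * \1_`[u, (u + e)%R] x)%:E = (e * m)%:E)%E.
    under eq_integral do rewrite EFinM.
    rewrite ge0_integralZl//; last by exact/measurable_EFinP/measurable_indic.
    rewrite integral_indic// setIT (_ : Measure.sort _ _ = e%:E); last exact: lamI.
    by rewrite -EFinM mulrC.
  have := intI (a - e); rewrite subrK => ->.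
  by rewrite intI -EFinD lee_fin; lra.
have intJ : (\int[lambda]_(x in J) (g x)%:E \is a fin_num)%E.
  rewrite ge0_fin_numE; last by apply: integral_ge0 => x _; rewrite lee_fin.
  apply: (@le_lt_trans _ _ (\int[lambda]_(x in J) m%:E)%E).
    apply: ge0_le_integral => //.
    - by move=> x _; rewrite lee_fin.
    - by apply/measurable_EFinP/measurable_funTS.
    - by move=> x _; rewrite lee_fin; have /andP[] := gm x.
  by rewrite integral_cst//= lebesgue_measure_itv/= lte_fin ab -EFinB -EFinM ltry.
set I1 := fine (\int[lambda]_(x in J) (g x)%:E)%E.
have IE : (\int[lambda]_(x in J) (g x)%:E)%E = I1%:E by rewrite fineK.
have I1le : I1 <= m * (b - a).
  rewrite -lee_fin -IE; apply: (@le_trans _ _ (\int[lambda]_(x in J) m%:E)%E).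
    apply: ge0_le_integral => //.
    - by move=> x _; rewrite lee_fin.
    - by apply/measurable_EFinP/measurable_funTS.
    - by move=> x _; rewrite lee_fin; have /andP[] := gm x.
  by rewrite integral_cst//= lebesgue_measure_itv/= lte_fin ab -EFinB -EFinM.
have UgE : \int[U]_x g x = (b - a)^-1 * I1.
  rewrite /Rintegral integral_uniform//; last exact/measurable_EFinP.
  by rewrite -/J IE.
have I10 : 0 <= I1 by apply: fine_ge0; apply: integral_ge0 => x _; rewrite lee_fin.
rewrite UgE /Rintegral integral_uniform//; last 2 first.
- by apply/measurable_EFinP; exact: measurableT_comp.
- by move=> x; rewrite lee_fin.
rewrite -lee_fin fineK; last first.
  rewrite ge0_fin_numE; last first.
    rewrite mule_ge0 ?lee_fin ?invr_ge0; [by []|lra|].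
    by apply: integral_ge0 => x _; rewrite lee_fin.
  apply: (le_lt_trans lem); apply: (@le_lt_trans _ _
    (((1 - e)^-1 * (b - a)^-1)%:E * (I1 + 2 * e * m)%:E)%E).
    rewrite lee_pmul2l ?EFinD -?IE//.
    by rewrite lte_fin mulr_gt0// invr_gt0; lra.
  by rewrite -EFinM ltry.
apply: (le_trans lem); apply: (@le_trans _ _
    (((1 - e)^-1 * (b - a)^-1)%:E * (I1 + 2 * e * m)%:E)%E).
  rewrite lee_pmul2l ?EFinD -?IE//.
  by rewrite lte_fin mulr_gt0// invr_gt0; lra.
rewrite -EFinM lee_fin.
(* With [q = 1 / (b - a) <= 1/2] the overhang costs [q * (2 * e * m) <= e * m]. As [q * I1 <= m] and
   [e <= 1/2], the product [(1 + 2 * e) * (q * I1 + e * m)] is at most [q * I1 + 4 * e * m]. *)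
have i1 : (1 - e)^-1 <= 1 + 2 * e.
  by rewrite -[leLHS]mul1r ler_pdivrMr; [nra|lra].
set q := (b - a)^-1.
have q0 : 0 <= q by rewrite invr_ge0; lra.
have qba : q * (b - a) = 1 by rewrite mulVf//; lra.
have qI : q * I1 <= m by nra.
have qI0 : 0 <= q * I1 by rewrite mulr_ge0.
have q12 : q * 2 <= 1 by nra.
rewrite -[_^-1 * q * _]mulrA; apply: (@le_trans _ _ ((1 + 2 * e) * (q * (I1 + 2 * e * m)))).
  by rewrite ler_wpM2r// mulr_ge0// addr_ge0// !mulr_ge0.
have : q * (2 * e * m) <= e * m by have := mulr_ge0 e0 m0; nra.
have := mulr_ge0 e0 m0; nra.
Qed.

End uniform_perturbation.

(** * Logarithmic perturbations *)

Section log_perturbation.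
Context (R : realType).
Local Notation mR := (measurableTypeR R).

Lemma ln_lip (x y : R) : 2^-1 <= x -> 2^-1 <= y -> `|ln x - ln y| <= 2 * `|x - y|.
Proof.
have H (u v : R) : 2^-1 <= u -> 2^-1 <= v -> ln u - ln v <= 2 * `|u - v|.
  move=> u2 v2; have u0 : 0 < u by lra.
  have v0 : 0 < v by lra.
  rewrite -ln_div ?posrE//.
  have -> : u / v = 1 + (u - v) / v by rewrite mulrBl divff ?gt_eqF//; ring.
  apply: (le_trans (le_ln1Dx _)).
    by rewrite ltr_pdivlMr//; lra.
  rewrite ler_pdivrMr//.
  have := ler_norm (u - v); have := normr_ge0 (u - v); nra.
move=> x2 y2; rewrite ler_norml H// andbT.
by have := H y x y2 x2; rewrite distrC; lra.
Qed.

(** The function [al * expR] is its own derivative and its modulus is monotone, so its bound [th] at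
    both ends is a Lipschitz constant. *)
Lemma expR_lip (al x y th : R) : `|al * expR x| <= th -> `|al * expR y| <= th ->
  `|al * expR x - al * expR y| <= th * `|x - y|.
Proof.
have H (be u v : R) : 0 <= be -> be * expR u <= th -> be * expR v <= th ->
    be * expR u - be * expR v <= th * `|u - v|.
  move=> be0 hu hv; have := expR_ge1Dx (v - u); rewrite expRD expRN => h1.
  have eu := expR_gt0 u.
  have h2 : expR u - expR v <= expR u * (u - v).
    have e1 : expR u * (expR v / expR u) = expR v by rewrite mulrC divfK// gt_eqF.
    have := ler_wpM2l (ltW eu) h1; rewrite e1; lra.
  have h3 := ler_wpM2l be0 h2.
  have n1 := ler_norm (u - v); have n0 := normr_ge0 (u - v).
  have p0 : 0 <= be * expR u by rewrite mulr_ge0// ltW.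
  have h4 : be * expR u * (u - v) <= be * expR u * `|u - v| by rewrite ler_wpM2l.
  have h5 : be * expR u * `|u - v| <= th * `|u - v| by rewrite ler_wpM2r.
  lra.
move=> hx hy; rewrite !normrM !(gtr0_norm (expR_gt0 _)) in hx hy.
have Hx := H _ _ _ (normr_ge0 al) hx hy.
have Hy := H _ _ _ (normr_ge0 al) hy hx; rewrite distrC in Hy.
rewrite -mulrBr normrM -[`|al|]normr_id -normrM mulrBr ler_norml.
by apply/andP; split; lra.
Qed.

Context (a b : R) (ab : a < b).
Local Notation U := (uniform_prob ab).

(** The one-sided estimate applied to [g] gives the upper bound, applied to [m - g] the lower
    one. *)
Lemma uniform_perturbation_dist (p g : R -> R) (e m : R) :
  2 <= b - a -> 0 <= e -> e <= 2^-1 ->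
  measurable_fun setT (p : mR -> mR) ->
  (forall x, a <= x <= b -> `|p x| <= e) ->
  (forall x y, a <= x <= b -> a <= y <= b -> `|p x - p y| <= e * `|x - y|) ->
  measurable_fun setT (g : mR -> R) -> (forall x, 0 <= g x <= m) ->
  `|\int[U]_x g (x + p x) - \int[U]_x g x| <= 4 * e * m.
Proof.
move=> ba e0 e2 mp pe plip mg gm.
have bg : bounded_measurable (g : mR -> R).
  by split=> //; exists m => x; have /andP[g0 g1] := gm x; rewrite ger0_norm.
have bgp : bounded_measurable (fun x : mR => g (x + p x)).
  apply: (bounded_measurable_comp (h := fun x : mR => (x + p x : mR)) bg).
  exact: measurable_funD.
have bm : bounded_measurable (fun _ : mR => m) by exact: bounded_measurable_cst.
have gm' x : 0 <= m - g x <= m by have /andP[] := gm x; lra.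
have mg' : measurable_fun setT (fun x : mR => m - g x) by exact: measurable_funB.
have h1 := uniform_perturbation_le ab ba e0 e2 mp pe plip mg gm.
have h2 := uniform_perturbation_le ab ba e0 e2 mp pe plip mg' gm'.
rewrite !meanB// !mean_cst in h2.
by rewrite ler_norml; apply/andP; split; lra.
Qed.

(** In the logarithmic coordinate, subtracting [S] from [expR x] means adding
    [ln (1 - S * expR (- x))] to [x]; the signs [s] and [io] cover this and its variants. As
    [th <= 1/4], the argument of [ln] stays above 1/2, where [ln] is 2-Lipschitz: the perturbation
    has size and Lipschitz constant at most [2 * th]. *)
Lemma log_perturbation (s io al th m : R) (g : R -> R) :
  2 <= b - a -> th <= 4^-1 -> `|s| = 1 -> `|io| = 1 ->
  (forall x, a <= x <= b -> `|al * expR (io * x)| <= th) ->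
  measurable_fun setT (g : mR -> R) -> (forall x, 0 <= g x <= m) ->
  `|\int[U]_x g (x + s * ln (1 + al * expR (io * x))) - \int[U]_x g x| <= 8 * th * m.
Proof.
move=> ba th4 s1 io1 hal mg gm.
have th0 : 0 <= th.
  by apply: le_trans (hal a _); [exact: normr_ge0|rewrite lexx ltW].
have -> : 8 * th * m = 4 * (2 * th) * m by ring.
apply: (@uniform_perturbation_dist (fun x => s * ln (1 + al * expR (io * x)))) => //.
- by rewrite mulr_ge0.
- lra.
- apply: measurable_funM => //; apply: measurableT_comp => //.
  apply: measurable_funD => //; apply: measurable_funM => //.
  by apply: measurableT_comp => //; apply: measurable_funM.
- move=> x hx; rewrite normrM s1 mul1r.
  have h := hal x hx; have := h; rewrite ler_norml => /andP[h1 h2].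
  have := @ln_lip (1 + al * expR (io * x)) 1; rewrite ln1 subr0 => /(_ _ _)/le_trans.
  apply; [lra|lra|]; rewrite [1 + _]addrC addrK; lra.
- move=> x y hx hy; rewrite -mulrBr normrM s1 mul1r.
  have hX := hal x hx; have hY := hal y hy.
  have := hX; rewrite ler_norml => /andP[h1 h2].
  have := hY; rewrite ler_norml => /andP[h3 h4].
  apply: (le_trans (ln_lip _ _)); [lra|lra|].
  have := expR_lip hX hY; rewrite -(mulrBr io) normrM io1 mul1r => H.
  have -> (u v : R) : 1 + u - (1 + v) = u - v by ring.
  lra.
Qed.

End log_perturbation.

Lemma big_option (R : nmodType) (I : finType) (F : option I -> R) :
  \sum_i F i = F None + \sum_i F (Some i).
Proof.
rewrite (bigD1 None)//=; congr (_ + _).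
rewrite (reindex_omap Some id)/=; last by case.
by apply: eq_bigl => i; rewrite eqxx.
Qed.

(** * Autocorrelation of a planar set *)

Section autocorrelation.
Context (R : realType).
Local Notation mR := (measurableTypeR R).
Local Notation mu := (borel_lebesgue2 R).

(* In the coordinates u = x - y, w = x + y the hyperbola is u * w = 1. *)
Definition lightcone (a : R) (v : R * R) : R * R :=
  (a * ((v.1 + v.2) / 2), a * ((v.2 - v.1) / 2)).

Lemma lightconeB (a : R) (p q : R * R) :
  lightcone a (p - q) = lightcone a p - lightcone a q.
Proof. by rewrite /lightcone /=; congr pair => /=; ring. Qed.

Lemma lightcone0 (a : R) : lightcone a 0 = 0.
Proof. by rewrite /lightcone /=; congr pair => /=; ring. Qed.

Lemma measurable_lightcone (a : R) :
  measurable_fun setT (lightcone a : mR * mR -> mR * mR).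
Proof.
apply: measurable_fun_pair => /=; apply: measurable_funM => //;
  apply: measurable_funM => //.
- by apply: measurable_funD.
- by apply: measurable_funB.
Qed.

Definition autocorr (B : set (mR * mR)) (a : R) (v : R * R) : R :=
  fine (mu (B `&` [set z : mR * mR | B (z + lightcone a v)])).

Lemma measurable_translate (B : set (mR * mR)) (v : R * R) : measurable B ->
  measurable [set z : mR * mR | B (z + v)].
Proof.
move=> mB; have ms : measurable_fun setT (fun z : mR * mR => (z + v : mR * mR)).
  by apply: measurable_fun_pair; apply: measurable_funD => //.
by have := ms measurableT B mB; rewrite setTI.
Qed.

Context (B : set (mR * mR)) (a : R) (mB : measurable B)
  (fB : (mu B < +oo)%E).
Local Notation c := (autocorr B a).

Lemma autocorr_ge0 v : 0 <= c v. Proof. exact: fine_ge0. Qed.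

Lemma autocorr_le v : c v <= fine (mu B).
Proof.
apply: fine_le; rewrite ?ge0_fin_numE//.
  apply: le_lt_trans fB; apply: le_measure; rewrite ?inE//.
  by apply: measurableI => //; exact: measurable_translate.
apply: le_measure; rewrite ?inE//.
by apply: measurableI => //; exact: measurable_translate.
Qed.

(** By translation invariance the Gram matrix of the translates of [B] depends only on differences
    of the translation vectors; this is what makes [autocorr] positive definite. *)
Lemma autocorr_translates p q :
  fine (mu ([set z | B (z + lightcone a p)] `&` [set z | B (z + lightcone a q)]))
  = c (q - p).
Proof.
rewrite /autocorr -[in RHS](borel_lebesgue2_shift (lightcone a p)); last first.
  by apply: measurableI => //; exact: measurable_translate.
have E (z : mR * mR) : z + lightcone a q = z + lightcone a p + lightcone a (q - p).
  by rewrite lightconeB -addrA [lightcone a p + _]addrC subrK.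
congr (fine (mu _)); apply/seteqP.
split=> z -[h1 h2]; split => //.
  exact: (eq_ind _ B h2 _ (E z)).
exact: (eq_ind _ B h2 _ (esym (E z))).
Qed.

Lemma autocorr0 : c 0 = fine (mu B).
Proof.
rewrite /autocorr lightcone0; congr (fine (mu _)).
by apply/seteqP; split => z /=; rewrite addr0 => // -[].
Qed.

Lemma autocorrN v : c (- v) = c v.
Proof.
have := autocorr_translates v 0; rewrite sub0r => <-.
by rewrite setIC autocorr_translates subr0.
Qed.

Lemma autocorr_gram_ge0 (I : finType) (x : I -> R * R) (w : I -> R) :
  0 <= \sum_i \sum_j w i * w j * c (x j - x i).
Proof.
under eq_bigr do under eq_bigr do rewrite -autocorr_translates.
apply: gram_ge0 => i; first exact: measurable_translate.
by rewrite borel_lebesgue2_shift.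
Qed.

(* Cauchy-Schwarz against the indicator function of S. *)
Lemma autocorr_sum_ge (N : nat) (S : set (mR * mR)) (x : 'I_N -> R * R) :
  measurable S -> (0 < mu S < +oo)%E ->
  (forall i, [set z | B (z + lightcone a (x i))] `<=` S) ->
  (N%:R * fine (mu B)) ^+ 2 <= fine (mu S) * \sum_i \sum_j c (x j - x i).
Proof.
move=> mS /andP[S0 Soo] xS.
set s := fine (mu S); set m := fine (mu B).
have s0 : 0 < s by rewrite fine_gt0// S0.
(* With weight [- t] on [S] and 1 on each translate, the Gram form is
   [t ^+ 2 * s - 2 * t * (N * m) + G]; this [t] minimizes it. *)
pose t := N%:R * m / s.
pose D (i : option 'I_N) : set (mR * mR) :=
  if i is Some j then [set z | B (z + lightcone a (x j))] else S.
have Dm i : fine (mu [set z | B (z + lightcone a (x i))]) = m.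
  by rewrite borel_lebesgue2_shift.
have := @gram_ge0 _ _ _ mu (option 'I_N) D (fun i => if i is Some _ then 1 else - t).
have mD i : measurable (D i) by case: i => [i|] //=; exact: measurable_translate.
have fD i : (mu (D i) < +oo)%E.
  by case: i => [i|] //=; rewrite borel_lebesgue2_shift.
move=> /(_ mD fD); rewrite !big_option /= setIid -/s.
under [X in _ + X]eq_bigr do rewrite big_option /=.
under [X in _ + X + _]eq_bigr do rewrite setIidr// Dm.
under [X in _ + X]eq_bigr do rewrite setIidl// Dm.
have sumc (k : R) : \sum_(i < N) k = N%:R * k.
  by rewrite sumr_const card_ord mulr_natl.
rewrite big_split/= !sumc.
under [X in _ + (_ + X)]eq_bigr do under eq_bigr do
  rewrite mulr1 mul1r autocorr_translates.
set G := \sum_i \sum_j _ => H.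
have ts : t * s = N%:R * m by rewrite /t divfK// gt_eqF.
have -> : (N%:R * m) ^+ 2 = s * (t * t * s) by rewrite -ts; ring.
rewrite ler_pM2l//; have : 0 <= t * t * s - 2 * t * (N%:R * m) + G.
  by apply: le_trans H _; rewrite le_eqVlt; apply/orP; left; apply/eqP; ring.
by rewrite -ts; lra.
Qed.

Lemma measurable_autocorr_graph :
  measurable [set vz : (mR * mR) * (mR * mR) | B (vz.2 + lightcone a vz.1)].
Proof.
have ms : measurable_fun setT (fun vz : (mR * mR) * (mR * mR) =>
    (vz.2 + lightcone a vz.1 : mR * mR)).
  have ml : measurable_fun setT (fun vz : (mR * mR) * (mR * mR) =>
      (lightcone a vz.1 : mR * mR)).
    by apply: measurableT_comp => //; exact: measurable_lightcone.
  apply: measurable_fun_pair => /=; apply: measurable_funD => //.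
  - by apply: measurableT_comp.
  - exact: (measurableT_comp measurable_fst ml).
  - by apply: measurableT_comp.
  - exact: (measurableT_comp measurable_snd ml).
by have := ms measurableT B mB; rewrite setTI.
Qed.

(** The correlation is the measure of a section of the graph set above, taken with the finite
    measure that [mu] induces on [B]. *)
Lemma bounded_measurable_autocorr : bounded_measurable (c : mR * mR -> R).
Proof.
split; last first.
  by exists (fine (mu B)) => v; rewrite ger0_norm ?autocorr_ge0// autocorr_le.
apply: (measurableT_comp (@fine_measurable R setT measurableT)).
have := measurable_fun_xsection (mfrestr mB fB) measurable_autocorr_graph.
congr measurable_fun; apply/funext => v /=; rewrite /mfrestr /mrestr setIC.
by congr (mu _); apply/seteqP; split => z /=; rewrite /xsection/= inE.
Qed.

End autocorrelation.

(** * Comparing means through values on the interval alone *)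

Section uniform_mean.
Context (R : realType) (a b : R) (ab : a < b).
Local Notation mR := (measurableTypeR R).
Local Notation U := (uniform_prob ab).
Implicit Types f g : mR -> R.

Lemma uniform_mean_eq f g : bounded_measurable f -> bounded_measurable g ->
  (forall x, a <= x <= b -> f x = g x) -> \int[U]_x f x = \int[U]_x g x.
Proof.
move=> bf bg fg; have [mf [M fM]] := bf; have [mg [N gN]] := bg.
have bk k := @bounded_measurable_cst R _ mR k.
(* Adding [M + N] makes both integrands nonnegative, as [integral_uniform] requires. *)
apply: (@addIr _ (M + N)).
rewrite -[M + N](@mean_cst R _ mR U) -!meanD// /Rintegral.
have M0 : 0 <= M := le_trans (normr_ge0 _) (fM 0).
have N0 : 0 <= N := le_trans (normr_ge0 _) (gN 0).
rewrite !integral_uniform//.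
- congr (fine (_ * _)%E); apply: eq_integral => x.
  by rewrite inE/= in_itv/= => /fg ->.
- by apply/measurable_EFinP; exact: measurable_funD.
- by move=> x; rewrite lee_fin; have := gN x; rewrite ler_norml => /andP[]; lra.
- by apply/measurable_EFinP; exact: measurable_funD.
- by move=> x; rewrite lee_fin; have := fM x; rewrite ler_norml => /andP[]; lra.
Qed.

Lemma uniform_mean_le f g : bounded_measurable f -> bounded_measurable g ->
  (forall x, a <= x <= b -> f x <= g x) -> \int[U]_x f x <= \int[U]_x g x.
Proof.
(* [k] clamps its argument to [[a, b]]; this leaves both means unchanged and makes the inequality
   hold everywhere. *)
move=> bf bg fg; pose k (x : mR) : mR := Num.max a (Num.min x b).
have mk : measurable_fun setT k.
  by apply: measurable_maxr => //; exact: measurable_minr.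
have kJ x : a <= k x <= b by rewrite /k le_max lexx/= ge_max (ltW ab) ge_min lexx orbT.
have kE x : a <= x <= b -> x = k x.
  by move=> /andP[ax xb]; rewrite /k (min_idPl xb) (max_idPr ax).
have bfk : bounded_measurable (fun x => f (k x)) := bounded_measurable_comp bf mk.
have bgk : bounded_measurable (fun x => g (k x)) := bounded_measurable_comp bg mk.
rewrite (uniform_mean_eq bf bfk) => [|x /kE <-//].
rewrite (uniform_mean_eq bg bgk) => [|x /kE <-//].
by apply: mean_le => // x; exact: fg.
Qed.

Lemma uniform_mean_dist f g (e : R) :
  bounded_measurable f -> bounded_measurable g ->
  (forall x, a <= x <= b -> `|f x - g x| <= e) ->
  `|\int[U]_x f x - \int[U]_x g x| <= e.
Proof.
move=> bf bg fg; have bk := @bounded_measurable_cst R _ mR e.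
rewrite ler_norml -[e in - e](@mean_cst R _ mR U) lerNl opprB !lerBlDr.
rewrite -[X in _ && (_ <= X + _)](@mean_cst R _ mR U) -!meanD//.
by apply/andP; split; apply: uniform_mean_le => [||x /fg]; try exact: bounded_measurableD;
  rewrite // ler_norml => /andP[]; lra.
Qed.

End uniform_mean.

(** * Lower bound for the mean correlation off the curve *)

Section main_term.
Context (R : realType).
Local Notation mR := (measurableTypeR R).
Local Notation lambda := (@lebesgue_measure R).
Local Notation mu := (borel_lebesgue2 R).

(** The translated law is uniform on a subinterval of [[a, b]], so its density exceeds that of the
    uniform law on [[a, b]] by the ratio of the lengths. *)
Lemma uniform_shift_le (a b a1 b1 : R) (ab : a < b) (ab1 : a1 < b1) (k : R)
    (g : mR -> R) :
  bounded_measurable g -> (forall x, 0 <= g x) -> a <= a1 + k -> b1 + k <= b ->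
  \int[uniform_prob ab1]_x g (x + k) <=
  (b - a) / (b1 - a1) * \int[uniform_prob ab]_x g x.
Proof.
move=> bg g0 ak bk; have [mg _] := bg.
have r0 : 0 <= (b - a) / (b1 - a1) by rewrite divr_ge0; lra.
pose phi : mR -> mR := fun x => x + k.
have mphi : measurable_fun setT phi by exact: measurable_funD.
have bgk : bounded_measurable (fun x : mR => g (x + k)).
  exact: (bounded_measurable_comp bg mphi).
have i1 := bounded_measurable_integrable (uniform_prob ab1) bgk.
have i2 := bounded_measurable_integrable (uniform_prob ab) bg.
rewrite -lee_fin EFinM /Rintegral !fineK; last 2 first.
- exact: (integrable_fin_num measurableT i2).
- exact: (integrable_fin_num measurableT i1).
have -> : (\int[uniform_prob ab1]_x (g (x + k))%:E =
    \int[pushforward (uniform_prob ab1) phi]_x (g x)%:E)%E.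
  rewrite ge0_integral_pushforward//; first exact/measurable_EFinP.
  by move=> x _; rewrite /= lee_fin.
have -> : (((b - a) / (b1 - a1))%:E * \int[uniform_prob ab]_x (g x)%:E =
    \int[mscale (NngNum r0) (uniform_prob ab)]_x (g x)%:E)%E.
  rewrite ge0_integral_mscale//; first exact/measurable_EFinP.
  by move=> x _; rewrite lee_fin.
apply: ge0_le_measure_integral => //; last exact/measurable_EFinP.
move=> S mS; rewrite /pushforward /mscale/=.
have mpre : measurable (phi @^-1` S).
  by have := mphi measurableT S mS; rewrite setTI.
rewrite [leLHS](uniform_probE ab1 mpre).
rewrite [X in (_ <= _ * X)%E](uniform_probE ab mS) muleA -EFinM.
have -> : (b - a) / (b1 - a1) / (b - a) = (b1 - a1)^-1.
  by rewrite mulrAC divff ?mul1r//; lra.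
rewrite lee_pmul2l//; last by rewrite lte_fin invr_gt0; lra.
have -> : `[a1, b1]%classic `&` phi @^-1` S =
    [set x : mR | (`[a1 + k, b1 + k]%classic `&` S) (x + k)].
  apply/seteqP; split => x /=; rewrite !in_itv/= => -[h1 h2]; split => //.
    by move: h1 => /andP[]; lra.
  by move: h1 => /andP[]; lra.
have mI (u v : R) : measurable (`[u, v]%classic `&` S : set mR).
  by apply: measurableI => //; exact: measurable_itv.
rewrite lebesgue_measure_shift//; apply: le_measure; rewrite ?inE//.
move=> x [/= h1 h2]; split => //; move: h1; rewrite /= !in_itv/= => /andP[]; lra.
Qed.

Lemma uniform_shift2_le (a b a1 b1 a2 b2 : R) (ab : a < b) (ab1 : a1 < b1)
    (ab2 : a2 < b2) (k1 k2 : R) (g : mR * mR -> R) :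
  bounded_measurable g -> (forall x, 0 <= g x) ->
  a <= a1 + k1 -> b1 + k1 <= b -> a <= a2 + k2 -> b2 + k2 <= b ->
  \int[uniform_prob ab1]_x \int[uniform_prob ab2]_y g (x + k1, y + k2) <=
  (b - a) / (b1 - a1) * ((b - a) / (b2 - a2)) *
    \int[uniform_prob ab]_x \int[uniform_prob ab]_y g (x, y).
Proof.
move=> bg g0 h1 h2 h3 h4.
have r1 : 0 <= (b - a) / (b1 - a1) by rewrite divr_ge0; lra.
have r2 : 0 <= (b - a) / (b2 - a2) by rewrite divr_ge0; lra.
pose G (x : mR) := \int[uniform_prob ab]_y g (x, y).
have bG : bounded_measurable G by exact: bounded_measurable_expectationr.
have mD (k : R) : measurable_fun setT (fun x : mR => (x + k : mR)).
  exact: measurable_funD.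
have mF : measurable_fun setT (fun z : mR * mR => (z.1 + k1, z.2 + k2) : mR * mR).
  by apply: measurable_fun_pair => /=; apply: measurableT_comp (mD _) _.
apply: (@le_trans _ _ (\int[uniform_prob ab1]_x ((b - a) / (b2 - a2) * G (x + k1)))).
  apply: mean_le.
  - exact: (bounded_measurable_expectationr _ (bounded_measurable_comp bg mF)).
  - exact/bounded_measurableZ/(bounded_measurable_comp bG (mD k1)).
  - move=> x; apply: uniform_shift_le => //.
    exact: (bounded_measurable_pairl (x + k1) bg).
rewrite meanZ; last exact: (bounded_measurable_comp bG (mD k1)).
set s1 := (b - a) / (b1 - a1) in r1 *; set s2 := (b - a) / (b2 - a2) in r2 *.
rewrite [s1 * s2]mulrC -[s2 * s1 * _]mulrA ler_wpM2l// /s1.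
by apply: uniform_shift_le => // x; apply: Rintegral_ge0.
Qed.

Lemma uniform_mean2_sum_ge (a1 b1 a2 b2 : R) (ab1 : a1 < b1) (ab2 : a2 < b2)
    (N : nat) (F : 'I_N -> 'I_N -> mR * mR -> R) (k K : R) :
  (forall i j, bounded_measurable (F i j)) ->
  (forall y y', a1 <= y <= b1 -> a2 <= y' <= b2 ->
    k <= K * \sum_i \sum_j F i j (y, y')) ->
  k <= K * \sum_i \sum_j
    \int[uniform_prob ab1]_y \int[uniform_prob ab2]_y' F i j (y, y').
Proof.
move=> bF kF; pose T (z : mR * mR) := \sum_i \sum_j F i j z.
have bT : bounded_measurable T.
  by do 2 (apply: bounded_measurable_sum => ?); exact: bF.
have -> : \sum_i \sum_j
      \int[uniform_prob ab1]_y \int[uniform_prob ab2]_y' F i j (y, y') =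
    \int[uniform_prob ab1]_y \int[uniform_prob ab2]_y' T (y, y').
  under [RHS]eq_Rintegral => y _.
    rewrite mean_sum => [|i]; last first.
      apply: bounded_measurable_sum => j; exact: bounded_measurable_pairl.
    under eq_bigr => i _.
      rewrite mean_sum => [|j]; last exact: bounded_measurable_pairl.
      over.
    over.
  rewrite mean_sum => [|i]; last first.
    by apply: bounded_measurable_sum => j; exact: bounded_measurable_expectationr.
  apply: eq_bigr => i _; rewrite mean_sum// => j.
  exact: bounded_measurable_expectationr.
rewrite -meanZ; last exact: bounded_measurable_expectationr.
rewrite -[leLHS](mean_cst (uniform_prob ab1)); apply: uniform_mean_le.
- exact: bounded_measurable_cst.
- exact/bounded_measurableZ/bounded_measurable_expectationr.
move=> y yI; rewrite -meanZ; last exact: bounded_measurable_pairl.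
rewrite -[leLHS](mean_cst (uniform_prob ab2)); apply: uniform_mean_le.
- exact: bounded_measurable_cst.
- exact/bounded_measurableZ/bounded_measurable_pairl.
by move=> y' y'I; exact: kF.
Qed.

Lemma mu_box (u v : R) : u <= v ->
  mu (`[u, v]%classic `*` `[u, v]%classic) = ((v - u) ^+ 2)%:E.
Proof.
move=> uv; transitivity (lambda `[u, v]%classic * lambda `[u, v]%classic)%E.
  by apply: product_measure1E; exact: measurable_itv.
have -> : lambda `[u, v]%classic = (v - u)%:E.
  rewrite lebesgue_measure_itv/= lte_fin; case: ifPn => [_|]; first by rewrite -EFinB.
  rewrite -leNgt => vu; have /eqP -> : u == v by rewrite eq_le uv vu.
  by rewrite subrr.
by rewrite -EFinM expr2.
Qed.

(** The correlation at [(t, 1/t')] in the coordinates [ln t] and [ln t'], in which multiplying the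
    point by a positive integer is a translation. *)
Definition corr_exp (B : set (mR * mR)) (a : R) (z : mR * mR) : R :=
  autocorr B a (expR z.1, expR (- z.2)).

Lemma bounded_measurable_corr_exp (B : set (mR * mR)) (a : R) : measurable B ->
  (mu B < +oo)%E -> bounded_measurable (corr_exp B a).
Proof.
move=> mB fB; apply: (bounded_measurable_comp (bounded_measurable_autocorr a mB fB)
  (h := fun z : mR * mR => (expR z.1, expR (- z.2)) : mR * mR)).
apply: measurable_fun_pair => /=; apply: measurableT_comp => //.
exact: measurable_funN.
Qed.

Lemma main_term (B : set (mR * mR)) (a L delta x0 d : R) (N : nat)
    (Hd : x0 - d < x0 + d) :
  measurable B -> B `<=` square L -> 0 < a -> 0 <= x0 ->
  (1 < N)%N -> d = ln N%:R -> 18 <= N%:R * delta -> a * N%:R * expR x0 <= L ->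
  0 < L -> delta * L ^+ 2 <= fine (mu B) ->
  delta / 72 * fine (mu B) <=
  \int[uniform_prob Hd]_x \int[uniform_prob Hd]_y corr_exp B a (x, y).
Proof.
move=> mB BL a0 x00 N1 dE Nd aL L0; set m := fine (mu B) => dm.
set E := \int[_]_x _.
have N0 : 0 < N%:R :> R by rewrite ltr0n ltnW.
have d0 : 0 < d by lra.
have fB : (mu B < +oo)%E.
  apply: (@le_lt_trans _ _ (mu (`[0, L]%classic `*` `[0, L]%classic))).
    by apply: le_measure; rewrite ?inE//; exact: measurableX.
  by rewrite mu_box ?ltry// ltW.
have bc := bounded_measurable_autocorr a mB fB.
have bce := bounded_measurable_corr_exp a mB fB.
have m0 : 0 <= m by exact: fine_ge0.
(* [ln r] will be uniform on the left half of the interval and [- ln w] on the right half.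
   Multiplying [(r, w)] by [k < N] moves the first to the right and the second to the left by
   [ln k <= d], so both stay in the whole interval. *)
have H1 : x0 - d < x0 by lra.
have H2 : x0 < x0 + d by lra.
pose U1 := uniform_prob H1; pose U2 := uniform_prob H2.
pose x (r w : R) (i : 'I_N) : R * R := (i%:R * r, i%:R * w).
have xB r w i j : x r w j - x r w i = ((j%:R - i%:R) * r, (j%:R - i%:R) * w).
  by rewrite !mulrBl.
have pw (r w : R) : 0 < r -> r <= expR x0 -> 0 < w -> w <= expR (- x0) ->
    (N%:R * m) ^+ 2 <= 9 * L ^+ 2 *
      \sum_i \sum_j autocorr B a (x r w j - x r w i).
  move=> r0 rx w0 wx.
  (* The translations move each coordinate by at most [L], so the translates of [B] stay in this
     larger square. *)
  have muS : mu (`[- L, 2 * L]%classic `*` `[- L, 2 * L]%classic) =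
      (9 * L ^+ 2)%:E by rewrite mu_box; [congr EFin; ring|lra].
  have -> : 9 * L ^+ 2 =
      fine (mu (`[- L, 2 * L]%classic `*` `[- L, 2 * L]%classic)) by rewrite muS.
  apply: autocorr_sum_ge => //; first exact: measurableX.
    by rewrite muS ltry andbT lte_fin mulr_gt0// exprn_gt0.
  move=> i z /= /BL [/=]; rewrite !in_itv/= => /andP[h1 h2] /andP[h3 h4].
  have iN : i%:R <= N%:R :> R by rewrite ler_nat ltnW.
  have i0 : 0 <= i%:R :> R by [].
  have e1 : expR (- x0) <= expR x0 by rewrite ler_expR; lra.
  have k1 : a * (i%:R * r) <= L.
    apply: le_trans aL; rewrite -mulrA ler_wpM2l ?(ltW a0)//.
    by apply: ler_pM => //; exact: ltW.
  have k2 : a * (i%:R * w) <= L.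
    apply: le_trans aL; rewrite -mulrA ler_wpM2l ?(ltW a0)//.
    by apply: ler_pM => //; [exact: ltW|exact: le_trans e1].
  have k3 : 0 <= a * (i%:R * r) by rewrite !mulr_ge0// ltW.
  have k4 : 0 <= a * (i%:R * w) by rewrite !mulr_ge0// ltW.
  have E1 : a * ((i%:R * r + i%:R * w) / 2) =
    (a * (i%:R * r) + a * (i%:R * w)) / 2 by ring.
  have E2 : a * ((i%:R * w - i%:R * r) / 2) =
    (a * (i%:R * w) - a * (i%:R * r)) / 2 by ring.
  by split; apply/andP; split; lra.
pose F (i j : 'I_N) (z : mR * mR) : R :=
  autocorr B a (x (expR z.1) (expR (- z.2)) j - x (expR z.1) (expR (- z.2)) i).
have bF i j : bounded_measurable (F i j).
  apply: (bounded_measurable_comp bc (h := fun z : mR * mR =>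
    (x (expR z.1) (expR (- z.2)) j - x (expR z.1) (expR (- z.2)) i : mR * mR))).
  have me : measurable_fun setT (fun z : mR * mR => expR z.1).
    by apply: measurableT_comp.
  have me' : measurable_fun setT (fun z : mR * mR => expR (- z.2)).
    apply: measurableT_comp => //.
    exact: measurable_funN.
  by apply: measurable_fun_pair => /=; apply: measurable_funB; apply: measurable_funM.
have FE i j : \int[U1]_y \int[U2]_y' F i j (y, y') <=
    (if i == j then m else 0) + 4 * E.
  have E0 : 0 <= E.
    by apply: Rintegral_ge0 => ? _; apply: Rintegral_ge0 => ? _; exact: autocorr_ge0.
  (* The law on each half has twice the density of the law on the whole interval; the two variables
     together give the factor 4. *)
  have le4 (k : nat) : (0 < k < N)%N ->
      \int[U1]_y \int[U2]_y' autocorr B a (k%:R * expR y, k%:R * expR (- y')) <= 4 * E.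
    move=> /andP[k0 kN]; have k0' : 0 < k%:R :> R by rewrite ltr0n.
    have lk0 : 0 <= ln (k%:R : R) by rewrite ln_ge0// ler1n.
    have lkd : ln (k%:R : R) <= d.
      by rewrite dE ler_ln ?posrE// ler_nat ltnW.
    have := @uniform_shift2_le (x0 - d) (x0 + d) (x0 - d) x0 x0 (x0 + d) Hd H1 H2
      (ln k%:R) (- ln k%:R) _ bce (fun _ => autocorr_ge0 _ _ _).
    have -> : (x0 + d - (x0 - d)) / (x0 - (x0 - d)) *
        ((x0 + d - (x0 - d)) / (x0 + d - x0)) = 4 by field; lra.
    have q1 : x0 - d <= x0 - d + ln k%:R by lra.
    have q2 : x0 + ln k%:R <= x0 + d by lra.
    have q3 : x0 - d <= x0 + - ln k%:R by lra.
    have q4 : x0 + d + - ln k%:R <= x0 + d by lra.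
    move=> /(_ q1 q2 q3 q4) h.
    rewrite [leLHS](_ : _ = \int[U1]_y \int[U2]_y'
      corr_exp B a (y + ln k%:R, y' + - ln k%:R)); first exact: h.
    apply: eq_Rintegral => y _; apply: eq_Rintegral => y' _.
    congr (autocorr B a _); rewrite expRD opprD opprK expRD lnK ?posrE//.
    by rewrite [_ * k%:R]mulrC [X in (_, X)]mulrC.
  have [->|ij] := eqVneq i j.
    have -> : F j j = fun=> m.
      by apply/funext => z; rewrite /F subrr autocorr0.
    by rewrite !mean_cst lerDl mulr_ge0.
  rewrite add0r; have [lt_ij|le_ji] := ltnP i j.
    have := le4 (j - i)%N; rewrite subn_gt0 lt_ij.
    move=> /(_ (leq_ltn_trans (leq_subr _ _) (ltn_ord j))) h; apply: le_trans h.
    rewrite le_eqVlt; apply/orP; left; apply/eqP.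
    apply: eq_Rintegral => y _; apply: eq_Rintegral => y' _.
    rewrite /F xB; congr (autocorr B a _).
    by rewrite natrB; last exact: ltnW.
  have lt_ji : (j < i)%N by rewrite ltn_neqAle le_ji andbT eq_sym.
  have := le4 (i - j)%N; rewrite subn_gt0 lt_ji.
  move=> /(_ (leq_ltn_trans (leq_subr _ _) (ltn_ord i))) h; apply: le_trans h.
  rewrite le_eqVlt; apply/orP; left; apply/eqP.
  apply: eq_Rintegral => y _; apply: eq_Rintegral => y' _.
  rewrite /F -(autocorrN a mB) opprB xB; congr (autocorr B a _).
  by rewrite natrB; last exact: ltnW.
have key : (N%:R * m) ^+ 2 <= 9 * L ^+ 2 * (N%:R * m + N%:R * (N%:R * (4 * E))).
  apply: (@le_trans _ _ (9 * L ^+ 2 *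
      \sum_i \sum_j \int[U1]_y \int[U2]_y' F i j (y, y'))).
    apply: uniform_mean2_sum_ge => [//|y y' /andP[_ yx] /andP[xy' _]].
    by apply: (pw (expR y) (expR (- y'))); rewrite ?expR_gt0// ler_expR ?lerN2.
  rewrite ler_wpM2l//; first by rewrite mulr_ge0// sqr_ge0.
  apply: (@le_trans _ _ (\sum_(i < N) \sum_(j < N) ((if i == j then m else 0) + 4 * E))).
    by apply: ler_sum => i _; apply: ler_sum => j _.
  rewrite le_eqVlt; apply/orP; left; apply/eqP.
  rewrite (eq_bigr (fun=> m + N%:R * (4 * E))) => [|i _].
    by rewrite sumr_const card_ord -[_ *+ N]mulr_natl mulrDr.
  rewrite big_split/= sumr_const card_ord -[_ *+ N]mulr_natl -big_mkcond/=.
  by under eq_bigl do rewrite eq_sym; rewrite big_pred1_eq.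
have L2 : 0 < L ^+ 2 by rewrite exprn_gt0.
(* One factor [m] on the left of [key] is bounded below by [delta * L ^+ 2]. The diagonal term
   [9 * N * m] is then at most half of the left side, because [N * delta >= 18]; hence
   [72 = 2 * 9 * 4]. *)
have k1 : N%:R ^+ 2 * m * delta <= 9 * (N%:R * m + N%:R * (N%:R * (4 * E))).
  rewrite -(ler_pM2l L2); apply: le_trans (_ : (N%:R * m) ^+ 2 <= _).
    have -> : L ^+ 2 * (N%:R ^+ 2 * m * delta) = (N%:R ^+ 2 * m) * (delta * L ^+ 2) by ring.
    have -> : (N%:R * m) ^+ 2 = (N%:R ^+ 2 * m) * m by ring.
    by rewrite ler_wpM2l// mulr_ge0// sqr_ge0.
  by apply: le_trans key _; rewrite le_eqVlt; apply/orP; left; apply/eqP; ring.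
have k2 : N%:R * (18 * m) <= N%:R * (N%:R * delta * m).
  by rewrite ler_pM2l// ler_wpM2r.
have N2 : 0 < (N%:R : R) ^+ 2 by rewrite exprn_gt0.
rewrite -(ler_pM2l N2); move: k1 k2; rewrite !expr2; lra.
Qed.

End main_term.

(** * Changes of variable between two separated scales *)

Section off_diagonal.
Context (R : realType).
Local Notation mR := (measurableTypeR R).

Lemma mean_prod d d' (T : measurableType d) (T' : measurableType d')
    (P : probability T R) (P' : probability T' R) (f : T * T' -> R) :
  bounded_measurable f ->
  \int[(P \x P')%E]_z f z = \int[P]_x \int[P']_y f (x, y).
Proof.
move=> bf; have i1 := bounded_measurable_integrable (P \x P')%E bf.
have := @integral12_prod_meas1 _ _ _ _ _ P P' (EFin \o f) i1.
rewrite /Rintegral => <-; congr fine; apply: eq_integral => x _.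
rewrite /fubini_F /= fineK//; apply: integrable_fin_num => //.
exact: (bounded_measurable_integrable _ (bounded_measurable_pairl x bf)).
Qed.

Section scales.
Context (aS bS aT bT th m : R) (HS : aS < bS) (HT : aT < bT).
Hypotheses (lenS : 2 <= bS - aS) (lenT : 2 <= bT - aT).
Hypotheses (th4 : th <= 4^-1) (sep : expR (bS - aT) <= th).
Local Notation US := (uniform_prob HS).
Local Notation UT := (uniform_prob HT).
Let eta := 8 * th * m.

(** The smaller scale is marked [S] and the larger one [T]. Every perturbation below is controlled
    by a ratio of a number of the first to one of the second. *)
Let small (x y : R) : x <= bS -> aT <= y -> expR x * expR (- y) <= th.
Proof. by move=> xb ay; rewrite -expRD (le_trans _ sep)// ler_expR; lra. Qed.

Let mexp : measurable_fun setT (fun x : mR => (expR x : mR)).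
Proof. exact: measurable_expR. Qed.

Let mexpN : measurable_fun setT (fun x : mR => (expR (- x) : mR)).
Proof. by apply: measurableT_comp => //; exact: measurable_funN. Qed.

Let bmr (g : mR -> R) : measurable_fun setT g -> (forall u, 0 <= g u <= m) ->
  bounded_measurable g.
Proof.
by move=> mg gm; split=> //; exists m => u; have /andP[g0 g1] := gm u; rewrite ger0_norm.
Qed.

Let mlog (s io al : R) :
  measurable_fun setT (fun x : mR => (x + s * ln (1 + al * expR (io * x)) : mR)).
Proof.
apply: measurable_funD => //; apply: measurable_funM => //; apply: measurableT_comp => //.
apply: measurable_funD => //; apply: measurable_funM => //.
by apply: measurableT_comp => //; apply: measurable_funM.
Qed.

(** Here [expR t - S = expR (t + ln (1 - S * expR (- t)))]. *)
Lemma mean_exp_shift (g : mR -> R) (S : R) :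
  measurable_fun setT g -> (forall u, 0 <= g u <= m) -> 0 <= S <= expR bS ->
  `|\int[UT]_t g (expR t - S) - \int[UT]_t g (expR t)| <= eta.
Proof.
move=> mg gm /andP[S0 SbS].
have hal x : aT <= x <= bT -> `|- S * expR (- 1 * x)| <= th.
  move=> /andP[ax _]; rewrite normrM normrN mulN1r !ger0_norm ?expR_ge0//.
  by apply: le_trans (small (lexx bS) ax); rewrite ler_wpM2r ?expR_ge0.
have mge : measurable_fun setT (fun x : mR => g (expR x)).
  exact: (measurableT_comp mg mexp).
have := log_perturbation HT lenT th4 (normr1 R) (normrN1 R) hal mge (fun x => gm _).
rewrite (@uniform_mean_eq _ _ _ HT _ (fun t : mR => g (expR t - S)))//.
- apply: (bounded_measurable_comp (h := fun x : mR => _ ) (bmr mge _) (mlog _ _ _)) => u.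
  exact: gm.
- apply: (bounded_measurable_comp (h := fun t : mR => (expR t - S : mR)) (bmr mg gm)).
  exact: measurable_funB.
move=> x /hal; rewrite mul1r ler_norml => /andP[h1 _]; congr g.
rewrite expRD lnK ?posrE; last by move: th4; lra.
by rewrite mulrDr mulr1 mulNr mulrN mulrCA mulN1r -expRD subrr expR0 mulr1.
Qed.

Lemma mean_exp_contract (g : mR -> R) (S : R) :
  measurable_fun setT g -> (forall u, 0 <= g u <= m) -> 0 <= S <= expR bS ->
  `|\int[UT]_t g (expR (t - ln (1 + S * expR (- t)))) - \int[UT]_t g (expR t)| <= eta.
Proof.
move=> mg gm /andP[S0 SbS].
have hal x : aT <= x <= bT -> `|S * expR (- 1 * x)| <= th.
  move=> /andP[ax _]; rewrite normrM mulN1r !ger0_norm ?expR_ge0//.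
  by apply: le_trans (small (lexx bS) ax); rewrite ler_wpM2r ?expR_ge0.
have mge : measurable_fun setT (fun x : mR => g (expR x)).
  exact: (measurableT_comp mg mexp).
have := log_perturbation HT lenT th4 (normrN1 R) (normrN1 R) hal mge (fun x => gm _).
suff -> : \int[UT]_x g (expR (x + -1 * ln (1 + S * expR (-1 * x)))) =
    \int[UT]_t g (expR (t - ln (1 + S * expR (- t)))) by [].
by apply: eq_Rintegral => x _; rewrite !mulN1r.
Qed.

Lemma mean_log_perturbation (h : mR -> R) (W : R) :
  measurable_fun setT h -> (forall u, 0 <= h u <= m) -> 0 <= W <= expR (- aT) ->
  `|\int[US]_s h (s - ln (1 - W * expR s)) - \int[US]_s h s| <= eta.
Proof.
move=> mh hm /andP[W0 WaT].
have hal x : aS <= x <= bS -> `|- W * expR (1 * x)| <= th.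
  move=> /andP[_ xb]; rewrite normrM normrN mul1r !ger0_norm ?expR_ge0//.
  by apply: le_trans (small xb (lexx aT)); rewrite mulrC ler_wpM2l ?expR_ge0.
have := log_perturbation HS lenS th4 (normrN1 R) (normr1 R) hal mh hm.
suff -> : \int[US]_x h (x + -1 * ln (1 + - W * expR (1 * x))) =
    \int[US]_s h (s - ln (1 - W * expR s)) by [].
by apply: eq_Rintegral => x _; congr h; rewrite mulN1r mul1r mulNr.
Qed.

Let W_small (W s : R) : 0 <= W <= expR (- aT) -> aS <= s <= bS ->
  W * expR s <= 4^-1.
Proof.
move=> /andP[W0 WaT] /andP[_ sb]; apply: le_trans th4.
by apply: le_trans (small sb (lexx aT)); rewrite mulrC ler_wpM2l ?expR_ge0.
Qed.

Let m_log1 (W : R) : measurable_fun setT (fun s : mR => (s - ln (1 - W * expR s) : mR)).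
Proof.
apply: measurable_funB => //; apply: measurableT_comp => //.
by apply: measurable_funB => //; apply: measurable_funM.
Qed.

(** Here [W - expR (- s) = - expR (- (s - ln (1 - W * expR s)))]. *)
Lemma mean_inv_shift (g : mR -> R) (W : R) :
  measurable_fun setT g -> (forall u, 0 <= g u <= m) -> 0 <= W <= expR (- aT) ->
  `|\int[US]_s g (W - expR (- s)) - \int[US]_s g (- expR (- s))| <= eta.
Proof.
move=> mg gm hW.
have mh : measurable_fun setT (fun s : mR => g (- expR (- s))).
  by apply: (measurableT_comp mg); apply: measurable_funN.
have := mean_log_perturbation mh (fun s => gm _) hW.
rewrite (@uniform_mean_eq _ _ _ HS _ (fun s : mR => g (W - expR (- s))))//.
- exact: (bounded_measurable_comp (bmr mh (fun s => gm _)) (m_log1 W)).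
- apply: (bounded_measurable_comp (h := fun s : mR => (W - expR (- s) : mR)) (bmr mg gm)).
  exact: measurable_funB.
move=> s hs; congr g; have := W_small hW hs => Ws.
rewrite opprB expRD lnK ?posrE; last by lra.
by rewrite mulrBl mul1r -mulrA -expRD subrr expR0 mulr1 opprB.
Qed.

Context (c : mR * mR -> R).
Hypotheses (mc : measurable_fun setT c) (c0m : forall v, 0 <= c v <= m).

Let bc : bounded_measurable c.
Proof.
by split=> //; exists m => u; have /andP[g0 g1] := c0m u; rewrite ger0_norm.
Qed.

(** In a difference of points of the two scales the larger scale dominates the first coordinate and
    the smaller one the second; this mean keeps only the dominant parts. *)
Definition cross_mean := \int[UT]_t \int[US]_s c (expR t, - expR (- s)).
Local Notation X := cross_mean.

(** On the curve both coordinates depend on [s]. The substitution [s' = s - ln (1 - W * expR s)]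
    turns [W - expR (- s)] into [- expR (- s')], and [expR s] becomes [expR s' / (1 + W * expR s')]:
    the effect of [W] moves to the first coordinate. *)
Lemma mean_curve_perturbation (u W : R) : 0 <= W <= expR (- aT) ->
  `|\int[US]_s c (u - expR s, W - expR (- s)) -
    \int[US]_s c (u - expR (s - ln (1 + W * expR s)), - expR (- s))| <= eta.
Proof.
move=> hW; have /andP[W0 _] := hW.
pose h (s : mR) := c (u - expR (s - ln (1 + W * expR s)), - expR (- s)).
have mh : measurable_fun setT h.
  apply: (measurableT_comp mc); apply: measurable_fun_pair; last exact: measurable_funN.
  apply: measurable_funB => //; apply: measurableT_comp => //.
  apply: measurable_funB => //; apply: measurableT_comp => //.
  by apply: measurable_funD => //; apply: measurable_funM.
have bh : bounded_measurable h by apply: bmr => // s; exact: c0m.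
have := mean_log_perturbation mh (fun s => c0m _) hW.
rewrite (@uniform_mean_eq _ _ _ HS _ (fun s : mR => c (u - expR s, W - expR (- s))))//.
- exact: (bounded_measurable_comp bh (m_log1 W)).
- apply: (bounded_measurable_comp
    (h := fun s : mR => (u - expR s, W - expR (- s)) : mR * mR) bc).
  by apply: measurable_fun_pair; apply: measurable_funB.
move=> s hs; have Ws := W_small hW hs; have es := expR_gt0 s.
have q0 : 0 < 1 - W * expR s by lra.
rewrite /h; congr (c (_, _)).
  have es' : 0 < 1 + W * (expR s / (1 - W * expR s)).
    by rewrite ltr_pwDl// mulr_ge0// divr_ge0// ltW.
  rewrite !(expRD, expRN) !lnK ?posrE//; congr (_ - _).
  by field; apply/andP; split; lra.
rewrite opprB expRD lnK ?posrE//.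
by rewrite mulrBl mul1r -mulrA -expRD subrr expR0 mulr1 opprB.
Qed.

End scales.
End off_diagonal.

(** * Cancellation of the four correlations between two scales *)

Section off_diagonal_assembly.
Context (R : realType).
Local Notation mR := (measurableTypeR R).

Lemma bounded_measurable_expectationl d d' (T : measurableType d)
    (T' : measurableType d') (P : probability T R) (f : T * T' -> R) :
  bounded_measurable f -> bounded_measurable (fun y => \int[P]_x f (x, y)).
Proof.
move=> bf; apply: (@bounded_measurable_expectationr _ _ _ T' T P (fun z => f (z.2, z.1))).
apply: (bounded_measurable_comp (h := fun z : T' * T => (z.2, z.1)) bf).
by apply: measurable_fun_pair.
Qed.

Lemma dist_le (A x e : R) : `|A - x| <= e -> A <= x + e.
Proof. by rewrite ler_norml => /andP[_]; lra. Qed.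

Lemma dist_ge (A x e : R) : `|A - x| <= e -> x - e <= A.
Proof. by rewrite ler_norml => /andP[]; lra. Qed.

Lemma dist_sum (x e : R) :
  x + 2 * e + (x + 2 * e) - (x - 2 * e) - (x - 2 * e) = 8 * e.
Proof. by ring. Qed.

Lemma mean2_comb d d' (T : measurableType d) (T' : measurableType d')
    (P : probability T R) (P' : probability T' R) (f1 f2 f3 f4 : T * T' -> R) :
  bounded_measurable f1 -> bounded_measurable f2 -> bounded_measurable f3 ->
  bounded_measurable f4 ->
  \int[P]_x \int[P']_y (f1 (x, y) + f2 (x, y) - f3 (x, y) - f4 (x, y)) =
  \int[P]_x \int[P']_y f1 (x, y) + \int[P]_x \int[P']_y f2 (x, y) -
  \int[P]_x \int[P']_y f3 (x, y) - \int[P]_x \int[P']_y f4 (x, y).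
Proof.
move=> b1 b2 b3 b4; have b12 := bounded_measurableD b1 b2.
have b123 := bounded_measurableB b12 b3.
have E (f : T * T' -> R) (bf : bounded_measurable f) := bounded_measurable_expectationr P' bf.
rewrite -(meanD P (E _ b1) (E _ b2)).
rewrite -(meanB P (bounded_measurableD (E _ b1) (E _ b2)) (E _ b3)).
rewrite -(meanB P (bounded_measurableB (bounded_measurableD (E _ b1) (E _ b2)) (E _ b3)) (E _ b4)).
apply: eq_Rintegral => x _.
have B (f : T * T' -> R) (bf : bounded_measurable f) := bounded_measurable_pairl x bf.
by rewrite (meanB P' (B _ b123) (B _ b4)) (meanB P' (B _ b12) (B _ b3))
  (meanD P' (B _ b1) (B _ b2)).
Qed.

Ltac mfun := repeat first [
    exact: measurable_cst | exact: measurable_id | exact: measurable_fst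
  | exact: measurable_snd | apply: measurable_fun_pair => /=
  | apply: measurable_funD => /= | apply: measurable_funN => /=
  | apply: measurable_funM => /=
  | apply: (measurableT_comp (@measurable_expR R))
  | apply: (measurableT_comp (@measurable_ln R))
  | apply: (measurableT_comp measurable_fst)
  | apply: (measurableT_comp measurable_snd) ].

Context (aS bS aT bT th m : R) (HS : aS < bS) (HT : aT < bT).
Hypotheses (lenS : 2 <= bS - aS) (lenT : 2 <= bT - aT).
Hypotheses (th4 : th <= 4^-1) (sep : expR (bS - aT) <= th).
Local Notation US := (uniform_prob HS).
Local Notation UT := (uniform_prob HT).
Let eta := 8 * th * m.
Context (c : mR * mR -> R).
Hypotheses (mc : measurable_fun setT c) (c0m : forall v, 0 <= c v <= m).
Local Notation X := (cross_mean HS HT c).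

Let bc : bounded_measurable c.
Proof.
by split=> //; exists m => u; have /andP[g0 g1] := c0m u; rewrite ger0_norm.
Qed.

(** Fubini puts the variables of the smaller scale inside, where they are averaged with [t] and [t']
    frozen; [K] is the intermediate value in a triangle inequality. *)
Lemma double_mean_dist (F : (mR * mR) * (mR * mR) -> R) (K : mR * mR -> R) (x e e' : R) :
  bounded_measurable F -> bounded_measurable K ->
  (forall t t', aT <= t <= bT -> aT <= t' <= bT ->
    `|\int[US]_s \int[US]_s' F ((s, s'), (t, t')) - K (t, t')| <= e) ->
  `|\int[UT]_t \int[UT]_t' K (t, t') - x| <= e' ->
  `|\int[(US \x US)%E]_w \int[(UT \x UT)%E]_z F (w, z) - x| <= e + e'.
Proof.
move=> bF bK FK Kx.
rewrite (mean_swap (US \x US)%E (UT \x UT)%E bF).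
have bG := bounded_measurable_expectationl (US \x US)%E bF.
rewrite (mean_prod UT UT bG).
apply: (le_trans (ler_distD (\int[UT]_t \int[UT]_t' K (t, t')) _ _)).
apply: lerD Kx.
apply: uniform_mean_dist; [exact: (bounded_measurable_expectationr UT bG)|
  exact: (bounded_measurable_expectationr UT bK)|move=> t tT].
apply: uniform_mean_dist; [exact: (bounded_measurable_pairl t bG)|
  exact: (bounded_measurable_pairl t bK)|move=> t' tT'].
rewrite (mean_prod US US (bounded_measurable_pairr (t, t') bF)).
exact: FK.
Qed.

(** This point and the next are functions of the same pair of logarithmic coordinates, so one
    product law governs both. *)
Definition off_curve (z : mR * mR) : mR * mR := (expR z.1, expR (- z.2)).
Definition on_curve (z : mR * mR) : mR * mR := (expR z.1, expR (- z.1)).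

Lemma measurable_off_curve : measurable_fun setT off_curve.
Proof. by rewrite /off_curve; mfun. Qed.

Lemma measurable_on_curve : measurable_fun setT on_curve.
Proof. by rewrite /on_curve; mfun. Qed.

Lemma bounded_measurable_difference (p q : mR * mR -> mR * mR) : measurable_fun setT p ->
  measurable_fun setT q ->
  bounded_measurable (fun wz : (mR * mR) * (mR * mR) =>
    c ((p wz.2).1 - (q wz.1).1, (p wz.2).2 - (q wz.1).2)).
Proof.
move=> mp mq; apply: (bounded_measurable_comp bc (h := fun wz : (mR * mR) * (mR * mR) =>
  ((p wz.2).1 - (q wz.1).1, (p wz.2).2 - (q wz.1).2) : mR * mR)).
have m1 : measurable_fun setT (fun wz : (mR * mR) * (mR * mR) => p wz.2).
  exact: (measurableT_comp mp measurable_snd).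
have m2 : measurable_fun setT (fun wz : (mR * mR) * (mR * mR) => q wz.1).
  exact: (measurableT_comp mq measurable_fst).
apply: measurable_fun_pair; apply: measurable_funB.
- exact: (measurableT_comp measurable_fst m1).
- exact: (measurableT_comp measurable_fst m2).
- exact: (measurableT_comp measurable_snd m1).
- exact: (measurableT_comp measurable_snd m2).
Qed.

Let mean_m (g : mR -> R) : bounded_measurable g -> (forall u, 0 <= g u <= m) ->
  0 <= \int[US]_s g s <= m.
Proof.
move=> bg gm; rewrite Rintegral_ge0; last by move=> u _; have /andP[] := gm u.
rewrite -[leRHS](mean_cst US); apply: mean_le => //.
  exact: bounded_measurable_cst.
by move=> u; have /andP[] := gm u.
Qed.

Let G (u : mR) := \int[US]_s c (u, - expR (- s)).

Let bG2 : bounded_measurable (fun z : mR * mR => c (z.1, - expR (- z.2))).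
Proof.
apply: (bounded_measurable_comp bc (h := fun z : mR * mR => (z.1, - expR (- z.2)) : mR * mR)).
by mfun.
Qed.

Let bG : bounded_measurable G.
Proof. exact: bounded_measurable_expectationr bG2. Qed.

Let Gm u : 0 <= G u <= m.
Proof.
by apply: mean_m => [|s]; [exact: (bounded_measurable_pairl u bG2)|exact: c0m].
Qed.

Let expRS s : aS <= s <= bS -> 0 <= expR s <= expR bS.
Proof. by move=> /andP[_ sb]; rewrite expR_ge0 ler_expR. Qed.

Let expRT t : aT <= t <= bT -> 0 <= expR (- t) <= expR (- aT).
Proof. by move=> /andP[ta _]; rewrite expR_ge0 ler_expR lerN2. Qed.

(* The second coordinate of the point at the large scale is irrelevant here:
   W stands for it. *)
Lemma off_off_dist (W : mR * mR -> R) :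
  measurable_fun setT (fun z : mR * mR => (W z : mR)) ->
  (forall t t', aT <= t <= bT -> aT <= t' <= bT -> 0 <= W (t, t') <= expR (- aT)) ->
  `|\int[(US \x US)%E]_w \int[(UT \x UT)%E]_z
     c (expR z.1 - (off_curve w).1, W z - (off_curve w).2) - X| <= 2 * eta.
Proof.
move=> mW W0.
have -> : 2 * eta = eta + eta by ring.
pose p (z : mR * mR) : mR * mR := (expR z.1, W z).
have mp : measurable_fun setT p by apply: measurable_fun_pair => //; mfun.
have bF := bounded_measurable_difference mp measurable_off_curve.
have bK2 : bounded_measurable (fun z : mR * mR => G (expR z.1 - expR z.2)).
  apply: (bounded_measurable_comp bG (h := fun z : mR * mR => (expR z.1 - expR z.2 : mR))).
  by mfun.
(* Averaging over [s'] removes [W] at the cost [eta] and leaves [K]; averaging over [t] then removes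
   [expR s] at the same cost. *)
pose K (z : mR * mR) := \int[US]_s G (expR z.1 - expR s).
have bK : bounded_measurable K.
  apply: (bounded_measurable_expectationr US (f := fun z : (mR * mR) * mR =>
    G (expR z.1.1 - expR z.2))).
  apply: (bounded_measurable_comp bK2 (h := fun z : (mR * mR) * mR => (z.1.1, z.2) : mR * mR)).
  by mfun.
apply: (double_mean_dist bF bK).
  move=> t t' tT tT'; rewrite /K /=.
  apply: uniform_mean_dist.
  - exact: (bounded_measurable_expectationr US (bounded_measurable_pairr (t, t') bF)).
  - exact: (bounded_measurable_pairl t bK2).
  move=> s sS; apply: (mean_inv_shift HS lenS th4 sep
    (bounded_measurable_pairl (expR t - expR s) bc).1 _ (W0 _ _ tT tT')) => u.
  exact: c0m.
have -> : \int[UT]_t \int[UT]_t' K (t, t') = \int[UT]_t \int[US]_s G (expR t - expR s).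
  by apply: eq_Rintegral => t _; rewrite /K /= mean_cst.
rewrite (mean_swap UT US bK2) -[X](mean_cst US).
apply: uniform_mean_dist.
- exact: (bounded_measurable_expectationl UT bK2).
- exact: bounded_measurable_cst.
by move=> s sS; apply: (mean_exp_shift HT lenT th4 sep) (expRS sS) => //; case: bG.
Qed.

Let bH (W : mR * mR -> R) : measurable_fun setT (fun z : mR * mR => (W z : mR)) ->
  bounded_measurable (fun z : (mR * mR) * mR =>
    c (expR z.1.1 - expR (z.2 - ln (1 + W z.1 * expR z.2)), - expR (- z.2))).
Proof.
move=> mW; apply: (bounded_measurable_comp bc (h := fun z : (mR * mR) * mR =>
  (expR z.1.1 - expR (z.2 - ln (1 + W z.1 * expR z.2)), - expR (- z.2)) : mR * mR)).
have mW' : measurable_fun setT (fun z : (mR * mR) * mR => (W z.1 : mR)).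
  exact: (measurableT_comp mW measurable_fst).
by mfun.
Qed.

(** [mean_curve_perturbation] moves [W] into the first coordinate at the cost [eta]. What remains
    depends on how [W] is related to [t], and is left as a hypothesis with error [e]. *)
Lemma off_on_dist (W : mR * mR -> R) (e : R) :
  measurable_fun setT (fun z : mR * mR => (W z : mR)) ->
  (forall t t', aT <= t <= bT -> aT <= t' <= bT -> 0 <= W (t, t') <= expR (- aT)) ->
  `|\int[UT]_t \int[UT]_t' \int[US]_s
     c (expR t - expR (s - ln (1 + W (t, t') * expR s)), - expR (- s)) - X| <= e ->
  `|\int[(US \x US)%E]_w \int[(UT \x UT)%E]_z
     c (expR z.1 - (on_curve w).1, W z - (on_curve w).2) - X| <= eta + e.
Proof.
move=> mW W0 HX.
pose p (z : mR * mR) : mR * mR := (expR z.1, W z).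
have mp : measurable_fun setT p by apply: measurable_fun_pair => //; mfun.
have bF := bounded_measurable_difference mp measurable_on_curve.
have bK := bounded_measurable_expectationr US (bH mW).
apply: (double_mean_dist bF bK _ HX) => t t' tT tT' /=.
under eq_Rintegral do rewrite mean_cst.
exact: (mean_curve_perturbation HS lenS th4 sep mc c0m (expR t) (W0 _ _ tT tT')).
Qed.

Let bX : bounded_measurable (fun z : mR * mR => c (expR z.1, - expR (- z.2))).
Proof.
apply: (bounded_measurable_comp bc (h := fun z : mR * mR =>
  (expR z.1, - expR (- z.2)) : mR * mR)).
by mfun.
Qed.

Let mc2 (w : mR) : measurable_fun setT (fun u : mR => c (u, w)).
Proof. exact: (bounded_measurable_pairr w bc).1. Qed.

(** Here [W = 1/t'] does not depend on [t]. With [t'] and [s] frozen, at most [expR s] is subtracted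
    from [expR t], so [mean_exp_shift] applies. *)
Lemma off_on_cross : 
  `|\int[(US \x US)%E]_w \int[(UT \x UT)%E]_z
     c (expR z.1 - (on_curve w).1, expR (- z.2) - (on_curve w).2) - X| <= 2 * eta.
Proof.
have -> : 2 * eta = eta + eta by ring.
have mW : measurable_fun setT (fun z : mR * mR => (expR (- z.2) : mR)) by mfun.
apply: (off_on_dist mW) => [t t' _|]; first exact: expRT.
have bF := bH mW; have bK := bounded_measurable_expectationr US bF.
rewrite (mean_swap UT UT bK) -[X](mean_cst UT).
apply: uniform_mean_dist; [exact: (bounded_measurable_expectationl UT bK)|
  exact: bounded_measurable_cst|move=> t' tT' /=].
have bF' : bounded_measurable (fun z : mR * mR =>
    c (expR z.1 - expR (z.2 - ln (1 + expR (- t') * expR z.2)), - expR (- z.2))).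
  apply: (bounded_measurable_comp bF (h := fun z : mR * mR => ((z.1, t'), z.2))).
  by mfun.
rewrite /cross_mean (mean_swap UT US bX) (mean_swap UT US bF').
apply: uniform_mean_dist; [exact: (bounded_measurable_expectationl UT bF')|
  exact: (bounded_measurable_expectationl UT bX)|move=> s sS /=].
apply: (mean_exp_shift HT lenT th4 sep (mc2 _)) => [u|]; first exact: c0m.
have /andP[e0 eb] := expRS sS.
rewrite expR_ge0 (le_trans _ eb)// ler_expR lerBlDr lerDl ln_ge0//.
by rewrite lerDl mulr_ge0// expR_ge0.
Qed.

(** Here [W] is the reciprocal of [tau = expR t] itself. With [sigma = expR s], the identity [tau -
    sigma / (1 + sigma / tau) = tau / (1 + sigma / tau)] reduces the claim to
    [mean_exp_contract]. *)
Lemma on_on_cross : 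
  `|\int[(US \x US)%E]_w \int[(UT \x UT)%E]_z
     c (expR z.1 - (on_curve w).1, expR (- z.1) - (on_curve w).2) - X| <= 2 * eta.
Proof.
have -> : 2 * eta = eta + eta by ring.
have mW : measurable_fun setT (fun z : mR * mR => (expR (- z.1) : mR)) by mfun.
apply: (off_on_dist mW) => [t t' tT _|]; first exact: expRT.
have bF : bounded_measurable (fun z : mR * mR =>
    c (expR (z.1 - ln (1 + expR z.2 * expR (- z.1))), - expR (- z.2))).
  apply: (bounded_measurable_comp bc (h := fun z : mR * mR =>
    (expR (z.1 - ln (1 + expR z.2 * expR (- z.1))), - expR (- z.2)) : mR * mR)).
  by mfun.
have -> : \int[UT]_t \int[UT]_t' \int[US]_s
     c (expR t - expR (s - ln (1 + expR (- t) * expR s)), - expR (- s)) =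
   \int[UT]_t \int[US]_s c (expR (t - ln (1 + expR s * expR (- t))), - expR (- s)).
  apply: eq_Rintegral => t _; rewrite mean_cst; apply: eq_Rintegral => s _.
  have es := expR_gt0 s; have et := expR_gt0 t.
  have h0 : 0 < 1 + expR s * (expR t)^-1 by rewrite ltr_pwDl// mulr_ge0// ?invr_ge0 ltW.
  congr (c (_, _)); rewrite !(expRD, expRN) [_^-1 * expR s]mulrC lnK ?posrE//.
  by field; apply/andP; split; lra.
rewrite (mean_swap UT US bF) /cross_mean (mean_swap UT US bX).
apply: uniform_mean_dist; [exact: (bounded_measurable_expectationl UT bF)|
  exact: (bounded_measurable_expectationl UT bX)|move=> s sS /=].
apply: (mean_exp_contract HT lenT th4 sep (mc2 _)) (expRS sS) => u; exact: c0m.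
Qed.

(** Each of the four means is within [2 * eta] of [X], and the signs cancel [X]. *)
Lemma off_diagonal_le :
  \int[(US \x US)%E]_w \int[(UT \x UT)%E]_z
     (c (off_curve z - off_curve w) + c (on_curve z - on_curve w)
      - c (off_curve z - on_curve w) - c (on_curve z - off_curve w)) <= 8 * eta.
Proof.
have bF (p q : mR * mR -> mR * mR) : measurable_fun setT p -> measurable_fun setT q ->
    bounded_measurable (fun wz : (mR * mR) * (mR * mR) => c (p wz.2 - q wz.1)).
  exact: bounded_measurable_difference.
have b1 := bF _ _ measurable_off_curve measurable_off_curve.
have b2 := bF _ _ measurable_on_curve measurable_on_curve.
have b3 := bF _ _ measurable_off_curve measurable_on_curve.
have b4 := bF _ _ measurable_on_curve measurable_off_curve.
have mW : measurable_fun setT (fun z : mR * mR => (expR (- z.2) : mR)) by mfun.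
have mW' : measurable_fun setT (fun z : mR * mR => (expR (- z.1) : mR)) by mfun.
rewrite (mean2_comb _ _ b1 b2 b3 b4).
have h1 : `|\int[(US \x US)%E]_w \int[(UT \x UT)%E]_z
    c (off_curve z - off_curve w) - X| <= 2 * eta.
  exact: (off_off_dist mW (fun t t' _ => @expRT t')).
have h4 : `|\int[(US \x US)%E]_w \int[(UT \x UT)%E]_z
    c (on_curve z - off_curve w) - X| <= 2 * eta.
  exact: (off_off_dist mW' (fun t t' tT _ => @expRT t tT)).
have h2 : `|\int[(US \x US)%E]_w \int[(UT \x UT)%E]_z
    c (on_curve z - on_curve w) - X| <= 2 * eta.
  exact: on_on_cross.
have h3 : `|\int[(US \x US)%E]_w \int[(UT \x UT)%E]_z
    c (off_curve z - on_curve w) - X| <= 2 * eta.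
  exact: off_on_cross.
apply: (le_trans (lerB (lerB (lerD (dist_le h1) (dist_le h2)) (dist_ge h3))
  (dist_ge h4))).
by rewrite (dist_sum X eta).
Qed.

End off_diagonal_assembly.

(** * Bessel's inequality over many scales *)

Section separated_scales.
Context (R : realType).
Local Notation mR := (measurableTypeR R).

Lemma symmetric_double_sum (D : nat -> nat -> R) (K : nat) :
  (forall k l, D k l = D l k) ->
  \sum_(k < K) \sum_(l < K) D k l =
  \sum_(k < K) D k k + \sum_(k < K) \sum_(l < k) 2 * D l k.
Proof.
move=> sD; elim: K => [|K IH]; first by rewrite !big_ord0 addr0.
rewrite !big_ord_recr/=; under eq_bigr do rewrite big_ord_recr/=.
rewrite big_split/= IH -mulr_sumr.
have -> : \sum_(l < K) D K l = \sum_(l < K) D l K by apply: eq_bigr => l _; exact: sD.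
by ring.
Qed.

Context (c : mR * mR -> R) (m : R).
Hypotheses (bc : bounded_measurable c) (c0m : forall v, 0 <= c v <= m).
Hypotheses (cN : forall v : R * R, c (- v) = c v) (c0 : c 0 = m).
Hypothesis gram : forall (I : finType) (x : I -> R * R) (w : I -> R),
  0 <= \sum_i \sum_j w i * w j * c (x j - x i).

(** The Gram pairing of the off-curve minus on-curve combinations attached to [w] and to [z]. *)
Let D (w z : mR * mR) : R :=
  c (off_curve z - off_curve w) + c (on_curve z - on_curve w)
  - c (off_curve z - on_curve w) - c (on_curve z - off_curve w).

Let D_sym w z : D w z = D z w.
Proof.
rewrite /D -(cN (off_curve z - off_curve w)) -(cN (on_curve z - on_curve w)).
rewrite -(cN (off_curve z - on_curve w)) -(cN (on_curve z - off_curve w)) !opprB.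
by rewrite -!addrA; congr (_ + (_ + _)); rewrite addrC.
Qed.

Let D_diag z : D z z <= 2 * m.
Proof.
rewrite /D !subrr c0; have /andP[h1 _] := c0m (off_curve z - on_curve z).
have /andP[h2 _] := c0m (on_curve z - off_curve z); lra.
Qed.

(** Positive definiteness with weight [la] at the origin, -1 at the off-curve points and 1 at the
    on-curve points. The diagonal terms [D z z] are at most [2 * m], and symmetry folds the others
    onto the pairs [l < k]. *)
Lemma scales_pointwise (K : nat) (la : R) (om : nat -> mR * mR) :
  0 <= (la ^+ 2 * m + K%:R * (2 * m)) +
   \sum_(k < K) (- (2 * la) * (c (off_curve (om k)) - c (on_curve (om k)))) +
   \sum_(k < K) \sum_(l < k) 2 * D (om l) (om k).
Proof.
pose x (i : option ('I_K * bool)) : R * R := match i with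
  | None => 0 | Some (k, true) => off_curve (om k)
  | Some (k, false) => on_curve (om k) end.
pose w (i : option ('I_K * bool)) : R := match i with
  | None => la | Some (k, b) => if b then -1 else 1 end.
have H := gram x w.
have E2 (F : 'I_K * bool -> R) :
    \sum_i F i = \sum_(k < K) (F (k, true) + F (k, false)).
  transitivity (\sum_(k < K) \sum_(b : bool) F (k, b)).
    by rewrite pair_bigA /=; apply: eq_bigr => -[].
  by apply: eq_bigr => k _; rewrite big_bool.
pose dl k := - la * (c (off_curve (om k)) - c (on_curve (om k))).
have E3 : \sum_i \sum_j w i * w j * c (x j - x i) =
    la ^+ 2 * m + (\sum_(k < K) dl k + \sum_(k < K) (dl k + \sum_(l < K) D (om k) (om l))).
  rewrite big_option big_option /w /x subr0 c0 -expr2 -addrA; congr (_ + (_ + _)).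
    rewrite E2; apply: eq_bigr => k _; rewrite /dl !subr0; ring.
  rewrite E2; apply: eq_bigr => k _; rewrite !big_option !sub0r !cN !E2.
  rewrite addrACA -big_split/=; congr (_ + _).
    by rewrite /dl; ring.
  by apply: eq_bigr => l _; rewrite /D; ring.
rewrite E3 big_split/= (symmetric_double_sum _ (fun k l => D_sym (om k) (om l))) in H.
apply: le_trans H _.
have -> : \sum_(k < K) (- (2 * la) * (c (off_curve (om k)) - c (on_curve (om k)))) =
    \sum_(k < K) dl k + \sum_(k < K) dl k.
  by rewrite -big_split/=; apply: eq_bigr => k _; rewrite /dl; ring.
have hd : \sum_(k < K) D (om k) (om k) <= K%:R * (2 * m).
  apply: (@le_trans _ _ (\sum_(k < K) (2 * m))); first exact: ler_sum.
  by rewrite sumr_const card_ord [leRHS]mulr_natl.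
move: hd; set s1 := \sum_(k < K) D _ _; set s2 := \sum_(k < K) \sum_(l < k) _.
set s3 := \sum_(k < K) dl k; clear; move: s1 s2 s3 => s1 s2 s3; lra.
Qed.

(** In the average of [scales_pointwise] each scale contributes at most [- 2 * la * beta * m]
    linearly, since the mean on the curve vanishes, and each pair of scales at most
    [128 * th * m]. *)
Lemma separated_scales (K : nat) (beta th Lam d : R)
    (HU : forall k : nat, k%:R * Lam - d < k%:R * Lam + d) :
  0 < m -> 0 <= beta -> 1 <= d -> 0 <= Lam -> th <= 4^-1 ->
  expR (2 * d - Lam) <= th -> 256 * th <= beta ^+ 2 ->
  (forall k, (k < K)%N ->
     \int[uniform_prob (HU k)]_x c (expR x, expR (- x)) = 0) ->
  (forall k, (k < K)%N -> beta * m <=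
     \int[uniform_prob (HU k)]_x \int[uniform_prob (HU k)]_y c (expR x, expR (- y))) ->
  K%:R * beta ^+ 2 <= 4.
Proof.
move=> m0 beta0 d1 Lam0 th4 sep thb con coff.
have len x : 2 <= x + d - (x - d) by lra.
have sepkl (l k : nat) : (l < k)%N ->
    l%:R * Lam + d - (k%:R * Lam - d) <= 2 * d - Lam.
  move=> lk; have kl : l%:R + 1 <= k%:R :> R by rewrite -(natrD _ l 1) addn1 ler_nat.
  have := ler_wpM2r Lam0 kl; lra.
(* As [256 * th <= beta ^+ 2], the term in [th] is at most half of [k * beta ^+ 2]. *)
have fin (k : R) : 0 < k -> 0 <= 2 - k * beta ^+ 2 + 128 * (th * k) ->
    k * beta ^+ 2 <= 4.
  by move=> k0; have := ler_wpM2r (ltW k0) thb; lra.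
have [K0|K0] := posnP K; first by rewrite K0 mul0r.
pose U k := uniform_prob (HU k).
pose P (k : nat) : probability (mR * mR)%type R := (U k \x U k)%E.
(* This weight minimizes [la ^+ 2 * m - 2 * la * K * beta * m], the part of the averaged bound that
   depends on [la]. *)
pose la := K%:R * beta.
pose p (k : nat) (z : mR * mR) := - (2 * la) * (c (off_curve z) - c (on_curve z)).
pose q (l k : nat) (wz : (mR * mR) * (mR * mR)) := 2 * D wz.1 wz.2.
have boff : bounded_measurable (fun z : mR * mR => c (off_curve z)).
  by apply: (bounded_measurable_comp (h := @off_curve R) bc); exact: measurable_off_curve.
have bon : bounded_measurable (fun z : mR * mR => c (on_curve z)).
  by apply: (bounded_measurable_comp (h := @on_curve R) bc); exact: measurable_on_curve.
have bp k : bounded_measurable (p k).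
  exact/bounded_measurableZ/bounded_measurableB.
have bD : bounded_measurable (fun wz : (mR * mR) * (mR * mR) => D wz.1 wz.2).
  have bF (g h : mR * mR -> mR * mR) : measurable_fun setT g -> measurable_fun setT h ->
    bounded_measurable (fun wz : (mR * mR) * (mR * mR) => c (g wz.2 - h wz.1)).
    exact: (bounded_measurable_difference bc.1 c0m).
  apply: bounded_measurableB; [apply: bounded_measurableB; [apply: bounded_measurableD|]|];
    apply: bF; try exact: measurable_off_curve; exact: measurable_on_curve.
have bq l k : bounded_measurable (q l k) by exact: bounded_measurableZ.
have H := pair_expectation_ge0 P bp bq (scales_pointwise K la).
have hp k : (k < K)%N -> \int[P k]_x p k x <= - (2 * la) * (beta * m).
  move=> kK; rewrite /p meanZ; last exact: bounded_measurableB.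
  rewrite !mulNr lerN2 ler_wpM2l//; first by rewrite !mulr_ge0.
  rewrite meanB// (mean_prod (U k) (U k) boff) (mean_prod (U k) (U k) bon).
  have -> : \int[U k]_x \int[U k]_y c (on_curve (x, y)) = 0.
    rewrite -(con k kK); apply: eq_Rintegral => x _.
    exact: (mean_cst (U k) (c (expR x, expR (- x)))).
  by rewrite subr0; exact: coff.
have hq l k : (l < k)%N -> \int[P l]_x \int[P k]_y q l k (x, y) <= 128 * th * m.
  move=> lk.
  have -> : \int[P l]_x \int[P k]_y q l k (x, y) =
      2 * \int[P l]_x \int[P k]_y D x y.
    rewrite -(meanZ (P l) 2 (bounded_measurable_expectationr (P k) bD)).
    apply: eq_Rintegral => x _; exact: (meanZ (P k) 2 (bounded_measurable_pairl x bD)).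
  have -> : 128 * th * m = 2 * (8 * (8 * th * m)) by ring.
  rewrite ler_pM2l//; apply: off_diagonal_le => //.
  - by apply: le_trans sep; rewrite ler_expR sepkl.
  - by case: bc.
have s1 : \sum_(k < K) \int[P k]_x p k x <= K%:R * (- (2 * la) * (beta * m)).
  apply: (@le_trans _ _ (\sum_(k < K) (- (2 * la) * (beta * m)))).
    by apply: ler_sum => k _; exact: hp.
  by rewrite sumr_const card_ord [leRHS]mulr_natl.
have th0 : 0 <= th by apply: le_trans sep; exact: expR_ge0.
have s2 : \sum_(k < K) \sum_(l < k) \int[P l]_x \int[P k]_y q l k (x, y) <=
    K%:R * (K%:R * (128 * th * m)).
  apply: (@le_trans _ _ (\sum_(k < K) (K%:R * (128 * th * m)))).
    apply: ler_sum => k _; apply: (@le_trans _ _ (\sum_(l < k) (128 * th * m))).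
      by apply: ler_sum => l _; exact: hq.
    rewrite sumr_const card_ord -[leLHS]mulr_natl ler_wpM2r//.
      by rewrite !mulr_ge0// ltW.
    by rewrite ler_nat ltnW.
  by rewrite sumr_const card_ord [leRHS]mulr_natl.
have {}H := le_trans H (lerD (lerD (lexx _) s1) s2).
have KR : 0 < K%:R :> R by rewrite ltr0n.
have Km : 0 < m * K%:R by rewrite mulr_gt0.
move: H; rewrite /la; move: (K%:R) KR Km => k KR Km H.
have {}H : 0 <= m * k * (2 - k * beta ^+ 2 + 128 * (th * k)).
  by apply: le_trans H _; rewrite le_eqVlt; apply/orP; left; apply/eqP; ring.
by apply: fin => //; rewrite pmulr_rge0 in H.
Qed.

End separated_scales.

(** * Density bound for one dilation *)

Section single_dilation.
Context (R : realType).
Local Notation mR := (measurableTypeR R).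
Local Notation mu := (borel_lebesgue2 R).

Lemma nat_approx (x : R) : 0 <= x -> exists N : nat, x < N%:R <= x + 1.
Proof.
move=> x0; exists (Num.truncn x).+1; have /andP[h1 h2] := truncn_itv x0.
by rewrite h2 /= -natr1 lerD2r.
Qed.

Lemma expR1_le4 : expR 1 <= 4 :> R.
Proof.
have := expR_ge1Dx (- 2^-1 : R); rewrite expRN => h.
have e0 := expR_gt0 (2^-1 : R).
have h2 : expR (2^-1) <= 2 :> R.
  have : 2^-1 * expR 2^-1 <= 1 :> R.
    have e1 : expR (2^-1 : R) != 0 by rewrite gt_eqF.
    by rewrite -[leRHS](mulVf e1) ler_wpM2r ?(ltW e0)//; lra.
  lra.
have E : expR (1 : R) = expR 2^-1 * expR 2^-1 by rewrite -expRD; congr expR; lra.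
by rewrite E; nra.
Qed.

Lemma ln_le_id (x : R) : 0 < x -> ln x <= x.
Proof.
move=> x0; have := @le_ln1Dx R (x - 1).
by rewrite addrCA subrr addr0 => /(_ _); lra.
Qed.

(** With [beta = delta / 72] and [th = beta ^+ 2 / 256], the choices are [N] about [18 / delta], [K]
    about [4 / beta ^+ 2], and [Lam = 2 * ln N - ln th], which makes the separation exactly [th].
    The last clause ensures that all scales fit into the square. *)
Lemma scale_parameters (a delta : R) : 0 < a -> 0 < delta <= 1 ->
  exists (N K : nat) (Lam : R),
  [/\ (1 < N)%N, 18 <= N%:R * delta, 1 <= ln (N%:R : R) &
   [/\ 0 <= Lam, expR (2 * ln N%:R - Lam) <= (delta / 72) ^+ 2 / 256,
   4 < K%:R * (delta / 72) ^+ 2 &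
   a * N%:R * expR (K%:R * Lam) <= expR ((a + 171) * 72 ^+ 3 / delta ^+ 3)]].
Proof.
move=> a0 /andP[d0 d1].
have [N /andP[N1 N2]] : exists N : nat, 18 / delta < N%:R <= 18 / delta + 1.
  by apply: nat_approx; rewrite divr_ge0// ltW.
set be := delta / 72; have be0 : 0 < be by rewrite divr_gt0.
have be2 : 0 < be ^+ 2 by rewrite exprn_gt0.
have [K /andP[K1 K2]] : exists K : nat, 4 / be ^+ 2 < K%:R <= 4 / be ^+ 2 + 1.
  by apply: nat_approx; rewrite divr_ge0// ltW.
have id1 : 1 <= delta^-1 by rewrite -[leLHS]invr1 lef_pV2 ?posrE.
have id0 : 0 < delta^-1 by rewrite invr_gt0.
have N18 : 18 <= N%:R :> R.
  by apply: le_trans (ltW N1); rewrite ler_pdivlMr//; lra.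
have N0 : 0 < N%:R :> R by lra.
have N19 : N%:R <= 19 * delta^-1 by lra.
set th := be ^+ 2 / 256; have th0 : 0 < th by rewrite divr_gt0.
have be1 : be <= 1 by rewrite /be; lra.
have th1 : th <= 1 by rewrite /th; nra.
have lnN1 : 1 <= ln (N%:R : R).
  rewrite -[leLHS](expRK 1) ler_ln ?posrE ?expR_gt0//.
  by apply: le_trans expR1_le4 _; lra.
exists N, K, (2 * ln N%:R - ln th); split => //.
- by rewrite -(ltr_nat R); lra.
- by rewrite -ler_pdivrMr// ltW.
have lnth : ln th <= 0 by rewrite -(@ln1 R) ler_ln// posrE.
have Lam0 : 0 <= 2 * ln N%:R - ln th by lra.
split => //.
- have -> : 2 * ln N%:R - (2 * ln N%:R - ln th) = ln th by ring.
  by rewrite lnK ?posrE.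
- by rewrite -ltr_pdivrMr.
(* In terms of [y = 1 / beta] one has [N <= y], [Lam <= 34 * y] and [K <= 5 * y ^+ 2], hence
   [K * Lam <= 170 * y ^+ 3]. The factors [a] and [N] are absorbed by [expR (a * y ^+ 3)] and
   [expR (y ^+ 3)], which makes [a + 171]. *)
set y := 72 * delta^-1; have y1 : 1 <= y by rewrite /y; lra.
have y0 : 0 < y by lra.
have bey : be^-1 = y by rewrite /be /y; field; lra.
have lnthE : - ln th = 2 * ln (16 * y).
  rewrite -lnV ?posrE// (_ : th^-1 = (16 * y) ^+ 2); last first.
    by rewrite /th -bey; field; lra.
  by rewrite lnXn ?mulr_gt0// -[_ *+ 2]mulr_natl.
have Ny : N%:R <= y by rewrite /y; lra.
have Lam1 : 2 * ln N%:R - ln th <= 34 * y.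
  rewrite lnthE; have := ln_le_id N0.
  have := @ln_le_id (16 * y); rewrite mulr_gt0// => /(_ isT).
  by move: (ln _) (ln _) => u v; lra.
have y2 : 1 <= y ^+ 2 by rewrite expr_ge1// ltW.
have K3 : K%:R <= 5 * y ^+ 2.
  apply: le_trans K2 _; have -> : 4 / be ^+ 2 = 4 * y ^+ 2 by rewrite -bey exprVn.
  by lra.
have y3 : y <= y ^+ 3 by rewrite exprS ler_peMr// ltW.
have y31 : 1 <= y ^+ 3 by apply: le_trans y3.
have KL : K%:R * (2 * ln N%:R - ln th) <= 170 * y ^+ 3.
  have -> : 170 * y ^+ 3 = (5 * y ^+ 2) * (34 * y) by ring.
  by apply: ler_pM.
have -> : (a + 171) * 72 ^+ 3 / delta ^+ 3 = a * y ^+ 3 + y ^+ 3 + 170 * y ^+ 3.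
  by rewrite /y exprMn exprVn; ring.
rewrite !expRD; apply: ler_pM => //.
- by rewrite mulr_ge0// ltW.
- apply: ler_pM => //; first exact: ltW.
    apply: (@le_trans _ _ (expR a)); first by have := expR_ge1Dx a; lra.
    by rewrite ler_expR ler_peMr ?(ltW a0).
  apply: (@le_trans _ _ (expR N%:R)); first by have := expR_ge1Dx (N%:R : R); lra.
  by rewrite ler_expR (le_trans Ny).
- by rewrite ler_expR.
Qed.

(** The scales are fixed before [L] and [B], so that [B] may later be defined through them. For
    density at least [delta], [main_term] feeds [separated_scales], whose conclusion contradicts the
    choice of [K]. *)
Lemma single_dilation (a : R) : 0 < a -> exists C : R, 0 < C /\
  forall delta, 0 < delta <= 1 ->
  exists (K : nat) (Lam d : R) (HU : forall k : nat, k%:R * Lam - d < k%:R * Lam + d),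
  forall (L : R) (B : set (mR * mR)), expR (C / delta ^+ 3) <= L ->
    measurable B -> B `<=` square L ->
    (forall k, (k < K)%N ->
      \int[uniform_prob (HU k)]_x autocorr B a (expR x, expR (- x)) = 0) ->
    fine (mu B) < delta * L ^+ 2.
Proof.
move=> a0; exists ((a + 171) * 72 ^+ 3); split; first by rewrite mulr_gt0// ?exprn_gt0//; lra.
move=> delta hd; have /andP[d0 d1] := hd.
have [N [K [Lam [N1 Nd lnN [Lam0 sep Kb CL]]]]] := scale_parameters a0 hd.
have HU (k : nat) : k%:R * Lam - ln (N%:R : R) < k%:R * Lam + ln N%:R by lra.
exists K, Lam, (ln N%:R), HU => L B LC mB BL con.
rewrite ltNge; apply/negP => dm.
have L0 : 0 < L by apply: lt_le_trans LC; exact: expR_gt0.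
have fB : (mu B < +oo)%E.
  apply: (@le_lt_trans _ _ (mu (`[0, L]%classic `*` `[0, L]%classic))).
    by apply: le_measure; rewrite ?inE//; exact: measurableX.
  by rewrite mu_box ?ltry// ltW.
have m0 : 0 < fine (mu B) by apply: lt_le_trans dm; rewrite mulr_gt0// exprn_gt0.
have be0 : 0 <= delta / 72 by rewrite divr_ge0// ltW.
have be1 : delta / 72 <= 1 by lra.
have be2 : (delta / 72) ^+ 2 <= 1 by rewrite expr_le1.
have c0m v : 0 <= autocorr B a v <= fine (mu B).
  by rewrite autocorr_ge0 autocorr_le.
have th4 : (delta / 72) ^+ 2 / 256 <= 4^-1.
  by move: be2; move: ((delta / 72) ^+ 2) => x; lra.
have thb : 256 * ((delta / 72) ^+ 2 / 256) <= (delta / 72) ^+ 2.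
  by rewrite mulrC divfK.
have coff k : (k < K)%N -> delta / 72 * fine (mu B) <=
    \int[uniform_prob (HU k)]_x \int[uniform_prob (HU k)]_y
      autocorr B a (expR x, expR (- y)).
  move=> kK; apply: (main_term (HU k) mB BL a0 _ N1 erefl Nd _ L0 dm).
    by rewrite mulr_ge0.
  apply: le_trans (le_trans CL LC); rewrite ler_wpM2l//.
    by rewrite mulr_ge0// ltW.
  by rewrite ler_expR ler_wpM2r// ler_nat ltnW.
have := separated_scales (bounded_measurable_autocorr a mB fB) c0m
  (autocorrN a mB) (autocorr0 B a) (autocorr_gram_ge0 a mB fB)
  m0 be0 lnN Lam0 th4 sep thb con coff.
by rewrite leNgt Kb.
Qed.

End single_dilation.

(** * A common starting point for all dilations *)

Section star_configuration.
Context (R : realType).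
Local Notation mR := (measurableTypeR R).
Local Notation mu := (borel_lebesgue2 R).

Lemma indic_iff T T' (A : set T) (B : set T') x y : (A x <-> B y) ->
  \1_A x = \1_B y :> R.
Proof.
move=> AB; rewrite !indicE; have [Ax|nAx] := pselect (A x).
  by rewrite !mem_set//; exact/AB.
by rewrite !memNset// => /AB.
Qed.

Section hitting_probability.
Context (A : set (mR * mR)) (a : R) (P : probability mR R) (h : mR -> mR * mR).
Hypotheses (mA : measurable A) (mh : measurable_fun setT h).

Definition hitting_probability (z : mR * mR) : \bar R :=
  P [set x | A (z + lightcone a (h x))].

Lemma measurable_hitting_set : measurable
  [set xz : mR * (mR * mR) | A (xz.2 + lightcone a (h xz.1))].
Proof.
have ml : measurable_fun setT (fun xz : mR * (mR * mR) =>
    (lightcone a (h xz.1) : mR * mR)).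
  apply: (measurableT_comp (measurable_lightcone a)).
  exact: (measurableT_comp mh measurable_fst).
have m2 : measurable_fun setT (fun xz : mR * (mR * mR) => xz.2).
  exact: measurable_snd.
have ms : measurable_fun setT (fun xz : mR * (mR * mR) =>
    (xz.2 + lightcone a (h xz.1) : mR * mR)).
  apply: measurable_fun_pair => /=; apply: measurable_funD.
  - exact: (measurableT_comp measurable_fst m2).
  - exact: (measurableT_comp measurable_fst ml).
  - exact: (measurableT_comp measurable_snd m2).
  - exact: (measurableT_comp measurable_snd ml).
by have := ms measurableT A mA; rewrite setTI.
Qed.

Lemma measurable_hitting_probability : measurable_fun setT hitting_probability.
Proof.
have := measurable_fun_ysection P measurable_hitting_set.
congr measurable_fun; apply/funext => z /=; congr (P _).
by apply/seteqP; split => x /=; rewrite /ysection/= inE.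
Qed.

(** Since [B] lies in [A], Tonelli bounds the mean by the integral of [hitting_probability] over
    [B]. *)
Lemma mean_autocorr_eq0 (B : set (mR * mR)) : measurable B ->
  (mu B < +oo)%E -> B `<=` A -> (forall z, B z -> hitting_probability z = 0%E) ->
  \int[P]_x autocorr B a (h x) = 0.
Proof.
move=> mB fB BA B0; pose nu := mfrestr mB fB.
pose W := [set xz : mR * (mR * mR) | B xz.2 /\ A (xz.2 + lightcone a (h xz.1))].
have mW : measurable W.
  have m2 := @measurable_snd _ _ mR (mR * mR)%type measurableT B mB.
  by rewrite setTI in m2; exact: (measurableI _ _ m2 measurable_hitting_set).
pose f (xz : mR * (mR * mR)) : \bar R := (\1_W xz : R)%:E.
have mI : measurable_fun setT f.
  by apply/measurable_EFinP; exact: measurable_indic.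
have I0 xz : (0 <= f xz)%E by rewrite lee_fin.
have key : (\int[P]_x \int[nu]_z (\1_W (x, z) : R)%:E = 0)%E.
  rewrite (@fubini_tonelli _ _ _ _ _ P nu f mI I0).
  apply: integral0_eq => z _ /=.
  transitivity (\int[P]_x (\1_[set x | W (x, z)] x : R)%:E)%E.
    apply: eq_integral => x _; congr EFin; exact: indic_iff.
  have mWz : measurable [set x | W (x, z)].
    have := measurable_ysection z mW.
    by congr measurable; apply/seteqP; split => x /=; rewrite /ysection/= inE.
  rewrite integral_indic// setIT.
  have [Bz|nBz] := pselect (B z).
    by rewrite -[RHS](B0 z Bz); congr (P _); apply/seteqP; split => x //= -[].
  by rewrite (_ : [set x | _] = set0) ?measure0//; apply/seteqP; split => x // -[].
apply/eqP; rewrite eq_le; apply/andP; split; last first.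
  by apply: Rintegral_ge0 => x _; exact: autocorr_ge0.
rewrite -lee_fin /Rintegral -[leRHS]key.
have mWx x : measurable [set z | W (x, z)].
  have := measurable_xsection x mW.
  by congr measurable; apply/seteqP; split => z /=; rewrite /xsection/= inE.
have nuE x : (\int[nu]_z (\1_W (x, z) : R)%:E = nu [set z | W (x, z)])%E.
  transitivity (\int[nu]_z (\1_[set z | W (x, z)] z : R)%:E)%E.
    apply: eq_integral => z _; congr EFin; exact: indic_iff.
  by rewrite integral_indic// setIT.
have le x : ((autocorr B a (h x))%:E <= \int[nu]_z (\1_W (x, z) : R)%:E)%E.
  rewrite nuE /autocorr fineK; last first.
    rewrite ge0_fin_numE//; apply: (le_lt_trans _ fB); apply: le_measure; rewrite ?inE//.
    by apply: measurableI => //; exact: measurable_translate.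
  rewrite /nu /mfrestr /mrestr; apply: le_measure; rewrite ?inE.
  - by apply: measurableI => //; exact: measurable_translate.
  - exact: measurableI.
  - by move=> z [Bz Bzh]; split => //; split => //; exact: BA.
have bc := bounded_measurable_comp (bounded_measurable_autocorr a mB fB) mh.
rewrite fineK; last first.
  exact: (integrable_fin_num measurableT (bounded_measurable_integrable P bc)).
apply: ge0_le_integral => //.
- by move=> x _; rewrite lee_fin; exact: autocorr_ge0.
- by apply/measurable_EFinP; case: bc.
- exact: (@measurable_fun_fubini_tonelli_F _ _ _ _ _ nu f mI I0).
Qed.

End hitting_probability.

Lemma measure_le_sum (I : eqType) (s : seq I) (F : I -> set (mR * mR))
    (A : set (mR * mR)) : measurable A -> (forall i, measurable (F i)) ->
  (forall x, A x -> exists2 i, i \in s & F i x) ->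
  (mu A <= \sum_(i <- s) mu (F i))%E.
Proof.
move=> + mF; elim: s A => [|i s IH] A mA AF.
  rewrite big_nil (_ : A = set0) ?measure0//.
  by apply/seteqP; split => x // /AF[].
rewrite big_cons; apply: (@le_trans _ _ (mu (F i `|` (A `\` F i)))).
  apply: le_measure; rewrite ?inE//.
    by apply: measurableU => //; exact: measurableD.
  by move=> x Ax; have [Fx|nFx] := pselect (F i x); [left|right].
apply: le_trans (measureU2 _ _ _) _ => //; first exact: measurableD.
rewrite leeD2l//; apply: IH => [|x [Ax nFx]]; first exact: measurableD.
by have [j + Fj] := AF x Ax; rewrite inE => /predU1P[ji|js];
  [rewrite ji in Fj|exists j].
Qed.

Lemma star_in_dense_set (n : nat) (a : 'I_n -> R) :
  (0 < n)%N -> (forall i, 0 < a i) ->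
  exists C : R, 0 < C /\
  forall (delta L : R) (A : set (mR * mR)), 0 < delta <= 1 ->
    expR (C / delta ^+ 3) <= L -> measurable A -> A `<=` square L ->
    delta * L ^+ 2 <= fine (mu A) -> has_configuration a A.
Proof.
move=> n0 a0.
have [C HC] := choice (fun i => single_dilation (a0 i)).
have nR : 0 < n%:R :> R by rewrite ltr0n.
have nR1 : 1 <= n%:R :> R by rewrite ler1n.
have C0 i : 0 < C i by case: (HC i).
(* The sum dominates every [C i], and [n ^+ 3] pays for using the density [delta / n]. *)
exists ((1 + \sum_i C i) * n%:R ^+ 3); split.
  by rewrite mulr_gt0 ?exprn_gt0// ltr_pwDl// sumr_ge0// => i _; exact: ltW.
move=> delta L A /andP[d0 d1] LC mA AL dA.
have L0 : 0 < L by apply: lt_le_trans LC; exact: expR_gt0.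
have fin B : measurable B -> B `<=` A -> (mu B < +oo)%E.
  move=> mB BA; apply: (@le_lt_trans _ _ (mu (`[0, L]%classic `*` `[0, L]%classic))).
    apply: le_measure; rewrite ?inE//; first exact: measurableX.
    exact: subset_trans AL.
  by rewrite mu_box ?ltry// ltW.
have dn : 0 < delta / n%:R <= 1.
  by rewrite divr_gt0//= ler_pdivrMr// mul1r (le_trans d1).
pose h (x : mR) : mR * mR := (expR x, expR (- x)).
have mh : measurable_fun setT h.
  apply: measurable_fun_pair; first exact: measurable_expR.
  by apply: measurableT_comp => //; exact: measurable_funN.
have bad i : exists B : set (mR * mR), [/\ measurable B, (mu B < (delta / n%:R * L ^+ 2)%:E)%E &
    forall z, A z -> ~ B z -> exists x, A (z + lightcone (a i) (h x))].
  have [K [Lam [d [HU Hi]]]] := (HC i).2 _ dn.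
  pose Z k := [set z | hitting_probability A (a i) (uniform_prob (HU k)) h z = 0%E].
  pose B := A `&` \bigcap_(k in `I_K) Z k.
  have mZ k : measurable (Z k).
    have := measurable_hitting_probability (a i) (uniform_prob (HU k)) mA mh.
    by move=> /(_ measurableT [set 0%E] (emeasurable_set1 _)); rewrite setTI.
  have mB : measurable B.
    by apply: measurableI => //; apply: bigcap_measurableType => k _; exact: mZ.
  have BA : B `<=` A by move=> z [].
  have fB := fin B mB BA.
  exists B; split => //.
    have := Hi L B _ mB (subset_trans BA AL) _.
    rewrite -lte_fin fineK ?ge0_fin_numE//; apply.
      apply: le_trans LC; rewrite ler_expR.
      rewrite expr_div_n invf_div mulrA.
      rewrite !ler_wpM2r ?invr_ge0 ?exprn_ge0 ?(ltW d0) ?(ltW nR)//.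
      rewrite (bigD1 i)//= addrCA lerDl addr_ge0//.
      by apply: sumr_ge0 => j _; exact: ltW.
    move=> k kK; apply: (mean_autocorr_eq0 mA mh mB fB BA) => z [_ Bz].
    exact: Bz.
  (* If no [x] worked, every hitting set of [z] would be empty and [z] would lie in all [Z k]. *)
  move=> z Az nBz; apply: contrapT => nx; apply: nBz; split => // k _.
  rewrite /Z /= /hitting_probability (_ : [set x | _] = set0) ?measure0//.
  by apply/seteqP; split => x // Ax; apply: nx; exists x.
have [B HB] := choice bad.
have [z Az nBz] : exists2 z, A z & forall i, ~ B i z.
  (* Otherwise the [B i] cover [A], although their measures sum to less than [delta * L ^+ 2];
     strictness of the sum uses [0 < n]. *)
  apply: contrapT => nz.
  have : (mu A <= \sum_(i <- index_enum 'I_n) mu (B i))%E.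
    apply: measure_le_sum => // [i|z Az]; first by case: (HB i).
    apply: contrapT => nB; apply: nz; exists z => // i Bz; apply: nB.
    by exists i => //; rewrite mem_index_enum.
  apply/negP; rewrite -ltNge.
  have finB i : (mu (B i) = (fine (mu (B i)))%:E)%E.
    rewrite fineK// ge0_fin_numE//.
    by case: (HB i) => _ lt _; apply: lt_trans lt _; rewrite ltry.
  under eq_bigr do rewrite finB.
  rewrite sumEFin -[ltRHS]fineK; last by rewrite ge0_fin_numE// fin.
  rewrite lte_fin; apply: lt_le_trans dA.
  have -> : delta * L ^+ 2 = \sum_(i < n) (delta / n%:R * L ^+ 2).
    rewrite sumr_const card_ord -[_ *+ n]mulr_natl mulrA; congr (_ * _).
    by rewrite mulrC divfK// gt_eqF.
  apply: ltr_sum => [|i _].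
    by apply/hasP; exists (Ordinal n0); rewrite ?mem_index_enum.
  by rewrite -lte_fin -finB; case: (HB i).
have [x Hx] := choice (fun i => (let: And3 _ _ H := HB i in H) z Az (nBz i)).
(* Back in the original coordinates: [v.1 - v.2 = expR x] and [v.1 + v.2 = expR (- x)], so
   [a i *: v i] is [lightcone (a i) (h (x i))]. *)
exists z, (fun i => ((expR (x i) + expR (- x i)) / 2, (expR (- x i) - expR (x i)) / 2)).
split => //.
move=> i; rewrite /hyperbola /=.
transitivity (expR (x i) * expR (- x i)); first by field.
by rewrite -expRD subrr expR0.
Qed.

End star_configuration.

(** * From Lebesgue-measurable to Borel sets *)

Section completion.
Context (R : realType).
Local Notation mR := (measurableTypeR R).
Local Notation mu := (borel_lebesgue2 R).

Lemma has_configurationS (n : nat) (a : 'I_n -> R) (A B : set (R * R)) :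
  A `<=` B -> has_configuration a A -> has_configuration a B.
Proof.
by move=> AB [z [v [hv Az Av]]]; exists z, v; split=> // [|i]; exact: AB.
Qed.

(** Configurations are sought in the Borel part [B], while [N] shows that no measure is lost by
    passing to it. *)
Lemma lebesgue_measurable2_borel (A : set (R * R)) : lebesgue_measurable2 A ->
  exists B N : set (mR * mR), [/\ measurable B, measurable N, mu N = 0%E,
    B `<=` A & A `<=` B `|` N].
Proof.
move=> [B mB [N [M [mM M0 NM]]] <-]; exists B, M; split => //.
by apply: setUS.
Qed.

Lemma lebesgue2_le (A : set (R * R)) (B : set (mR * mR)) :
  measurable B -> A `<=` B -> (lebesgue2 A <= mu B)%E.
Proof.
move=> mB AB; rewrite -(@measurable_mu_extE _ R _ mu B mB).
exact: le_mu_ext.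
Qed.

Lemma mu_null_union (B N : set (mR * mR)) : measurable B -> measurable N ->
  mu N = 0%E -> (mu (B `|` N) <= mu B)%E.
Proof.
move=> mB mN N0; apply: (le_trans (measureU2 mu mB mN)).
by rewrite -[leRHS]adde0; apply: leeD => //; rewrite -N0.
Qed.

Lemma mu_square (L : R) : 0 <= L -> mu (square L : set (mR * mR)) = (L ^+ 2)%:E.
Proof. by move=> L0; rewrite (mu_box L0) subr0. Qed.

End completion.

Theorem theorem10 (R : realType) (n : nat) (a : 'I_n -> R) :
  (0 < n)%N -> (forall i, 0 < a i) -> injective a ->
  exists C : R, 0 < C /\
    (forall (L : R) (A : set (R * R)),
        1 < L -> A `<=` square L -> lebesgue_measurable2 A ->
        (((C / ln L) `^ (1 / (2 * n + 1)%:R))%:E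
           <= lebesgue2 A / (L ^+ 2)%:E)%E ->
        has_configuration a A) /\
    (forall (L : R) (r : nat) (c : 'I_r -> set (R * R)),
        0 < L -> measurable_coloring (square L) c ->
        expR (C * r%:R ^+ (2 * n + 1)) <= L ->
        exists j : 'I_r, has_configuration a (c j)).
Proof.
move=> n0 a0 _; have [C [C0 HC]] := star_in_dense_set n0 a0.
have n3 : (3 <= 2 * n + 1)%N by rewrite addn1 ltnS; exact: (leq_mul (leqnn 2) n0).
(* For densities at most 1 the cubic condition of [star_in_dense_set] follows from the one with
   exponent [2 * n + 1 >= 3]. *)
have Cexp (x : R) : 0 < x <= 1 -> C / x ^+ 3 <= C / x ^+ (2 * n + 1).
  move=> /andP[x0 x1]; rewrite ler_pM2l// lef_pV2 ?posrE ?exprn_gt0//.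
  by apply: ler_wiXn2l => //; exact: ltW.
have msq (L : R) : measurable (square L : set (measurableTypeR R * measurableTypeR R)).
  by apply: measurableX; exact: measurable_itv.
exists C; split => //; split => [L A L1 AL mA|L r c L0 [cU ctriv mc] rL].
  have L0 : 0 < L by apply: lt_trans L1.
  have L20 : 0 < L ^+ 2 by rewrite exprn_gt0.
  have lnL : 0 < ln L by rewrite ln_gt0.
  set x := _ `^ _ => dA.
  have [B [N [mB mN N0 BA AN]]] := lebesgue_measurable2_borel mA.
  have x0 : 0 < x by rewrite powR_gt0// divr_gt0.
  have AB : (lebesgue2 A <= borel_lebesgue2 R B)%E.
    apply: le_trans (lebesgue2_le _ AN) _; first exact: measurableU.
    exact: mu_null_union.
  have BL : (borel_lebesgue2 R B <= (L ^+ 2)%:E)%E.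
    rewrite -(mu_square (ltW L0)); apply: le_measure; rewrite ?inE//.
    exact: subset_trans AL.
  have fB : borel_lebesgue2 R B \is a fin_num.
    by rewrite ge0_fin_numE// (le_lt_trans BL)// ltry.
  have xB : x * L ^+ 2 <= fine (borel_lebesgue2 R B).
    rewrite -lee_fin fineK// EFinM; apply: le_trans AB.
    (* The inverse in the extended reals has a special value at 0, excluded here by [0 < L ^+ 2]. *)
    move: dA; rewrite inver gt_eqF// => dA.
    by rewrite -lee_pdivlMr.
  (* The threshold is at most 1 because [B], which attains it, lies in the square. *)
  have x1 : x <= 1.
    rewrite -(ler_pM2r L20) mul1r (le_trans xB)// -lee_fin fineK//.
  (* Thus [C / x ^+ (2 * n + 1)] equals [ln L]. *)
  have xn : x ^+ (2 * n + 1) = C / ln L.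
    have k0 : (2 * n + 1)%:R != 0 :> R by rewrite pnatr_eq0 addn1.
    rewrite /x -powR_mulrn ?powR_ge0// -powRrM mul1r mulVf//.
    by rewrite powRr1// ltW// divr_gt0.
  apply: (has_configurationS BA).
  apply: (HC x L B _ _ mB (subset_trans BA AL) xB); first by rewrite x0.
  rewrite -[leRHS](lnK (x := L)) ?posrE// ler_expR.
  apply: le_trans (Cexp x _) _; first by rewrite x0.
  by rewrite xn invf_div mulrC divfK// gt_eqF.
(* With no colors the square would be empty, yet it contains the origin. *)
have r0 : (0 < r)%N.
  rewrite lt0n; apply/eqP => r0; move: c cU ctriv mc {rL}; rewrite r0 => c cU _ _.
  have : square L (0, 0) by split; rewrite /= in_itv/= lexx ltW.
  by rewrite -cU => -[[]].
have rR : 0 < r%:R :> R by rewrite ltr0n.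
have L20 : 0 < L ^+ 2 by rewrite exprn_gt0.
have HB j := lebesgue_measurable2_borel (mc j).
have [B HB'] := choice HB; have [N HN] := choice HB'.
have cL j : c j `<=` square L by rewrite -cU => z cz; exists j.
(* Pigeonhole on the Borel parts: together with the null sets they cover the square. *)
have [j jB] : exists j, (L ^+ 2) / r%:R <= fine (borel_lebesgue2 R (B j)).
  apply: contrapT => nj.
  have lt j : fine (borel_lebesgue2 R (B j)) < L ^+ 2 / r%:R.
    by rewrite ltNge; apply/negP => h; apply: nj; exists j.
  have : (borel_lebesgue2 R (square L) <=
      \sum_(j <- index_enum 'I_r) borel_lebesgue2 R (B j `|` N j))%E.
    apply: measure_le_sum => // [j|z].
      by case: (HN j) => mB mN _ _ _; exact: measurableU.
    rewrite -cU => -[j _ cz]; exists j; first by rewrite mem_index_enum.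
    by case: (HN j) => _ _ _ _; apply.
  apply/negP; rewrite -ltNge mu_square ?(ltW L0)//.
  have muE j : (borel_lebesgue2 R (B j `|` N j) <= (fine (borel_lebesgue2 R (B j)))%:E)%E.
    case: (HN j) => mB mN N0 BA _; rewrite fineK.
      exact: mu_null_union.
    rewrite ge0_fin_numE//; apply: (@le_lt_trans _ _ (borel_lebesgue2 R (square L))).
      by apply: le_measure; rewrite ?inE//; exact: subset_trans (cL j).
    by rewrite mu_square ?(ltW L0)// ltry.
  apply: le_lt_trans (lee_sum _ (fun j _ => muE j)) _.
  rewrite sumEFin lte_fin.
  have -> : L ^+ 2 = \sum_(j < r) (L ^+ 2 / r%:R).
    by rewrite sumr_const card_ord -[_ *+ r]mulr_natl mulrC divfK// gt_eqF.
  apply: ltr_sum => // .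
  by apply/hasP; exists (Ordinal r0); rewrite ?mem_index_enum.
have [mB _ _ Bc _] := HN j.
exists j; apply: (has_configurationS Bc).
(* The density is [1 / r], for which [C / (1 / r) ^+ (2 * n + 1)] is the exponent
   [C * r ^+ (2 * n + 1)] of the hypothesis on [L]. *)
have ri : 0 < (r%:R : R)^-1 <= 1.
  by rewrite invr_gt0 rR invf_le1// ler1n.
apply: (HC _ L (B j) ri _ mB (subset_trans Bc (cL j))); last by rewrite mulrC.
apply: le_trans rL; rewrite ler_expR; apply: le_trans (Cexp _ ri) _.
by rewrite exprVn invrK.
Qed.
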